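(* Let $n,m\ge1$, let $\mathcal{A}=\{a_0,a_1,\dots,a_{n+m}\}\subset\mathbb{Z}^n$ be a set of $n+m+1$ points not contained in an affine hyperplane, and let $C=(c_{ij})\in\mathbb{C}^{n\times(n+m+1)}$ have rank $n$, with the all-ones vector in its kernel. Let $B\in\mathbb{Z}^{(n+m+1)\times m}$ be any Gale dual matrix of $A$, where $A$ is the matrix with columns $(1,a_0),\dots,(1,a_{n+m})$, and let $D$ be a reduced Gale dual matrix of $C$. Then the system $\sum_{j=0}^{n+m}c_{ij}x^{a_j}=0$, $i=1,\dots,n$, has an isolated solution at $\mathbf{1}=(1,\dots,1)\in(\mathbb{C}^* )^n$ of multiplicity $\mu$ if and only if the associated Gale dual system $g_1(y)=\cdots=g_m(y)=0$ has an isolated solution at the origin of $\mathbb{C}^m$ of the same multiplicity $\mu$. As a consequence, the multiplicity at the origin of $g_1(y)=\cdots=g_m(y)=0$ depends neither on the choice of the reduced matrix $D$ nor on the choice of $B$.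
   Context: A Gale dual matrix of $A$ is an integer matrix $B=(b_{ik})\in\mathbb{Z}^{(n+m+1)\times m}$ of full rank $m$ whose columns lie in the kernel of $A$ (hence form a $\mathbb{Q}$-basis of the rational kernel). Rows are indexed $0,\dots,n+m$. A Gale dual matrix of $C$ is a complex matrix $D\in\mathbb{C}^{(n+m+1)\times(m+1)}$ whose columns form a basis of the right kernel of $C$. $D$ is reduced if its rows are $(1,\delta_0),\dots,(1,\delta_{n+m})$ with $\delta_i\in\mathbb{C}^m$ and $\delta_0=\mathbf{0}$; such a matrix exists exactly when the all-ones vector lies in the kernel of $C$, i.e. when $\mathbf{1}$ is a solution of the system. Put $p_i(y)=1+\langle\delta_i,y\rangle$, $i=0,\dots,n+m$, $y=(y_1,\dots,y_m)$, where $\langle\delta,y\rangle=\sum_j\delta_jy_j$. The Gale dual system is $$g_k(y)=\prod_{i:\,b_{ik}>0}p_i(y)^{b_{ik}}-\prod_{i:\,b_{ik}<0}p_i(y)^{-b_{ik}}=0,\quad k=1,\dots,m.$$ The multiplicity of an isolated solution is the complex dimension of the local ring at that point of the scheme defined by the equations. *)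

(* Defs.v *)
(* [mpoly] has to be imported before the files of MathComp-Analysis: in the
   other order some of its notations are rejected. *)
From mathcomp Require Import all_boot all_order all_algebra fraction.
From mathcomp Require Import complex.
From mathcomp Require Import mpoly.
From mathcomp Require Import classical_sets reals topology normedtype.
Import numFieldNormedType.Exports.

Set Implicit Arguments.
Unset Strict Implicit.
Unset Printing Implicit Defensive.

Import Order.TTheory GRing.Theory Num.Theory.
Local Open Scope ring_scope.

Section Multiplicity.
Variables (K : fieldType) (n r : nat).

(* The field K(X_1, ..., X_n) of rational functions. *)
Definition ratfun : fieldType := {fraction {mpoly K[n]}}.

Definition polyf (u : {mpoly K[n]}) : ratfun := FracField.tofrac u.

Definition constf (c : K) : ratfun := polyf c%:MP.

(* The local ring of affine n-space at p, i.e. the localization of K[X] at the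
   maximal ideal of p, is the subring of K(X) of the functions regular at p.
   If p has no zero coordinate, it is also the localization of the Laurent
   polynomial ring, i.e. the local ring of the torus at p. *)
Definition regular_at (p : 'rV[K]_n) (q : ratfun) : Prop :=
  exists u v : {mpoly K[n]}, v.@[p 0] != 0 /\ q = polyf u / polyf v.

(* The ideal generated by f_1, ..., f_r in the local ring at p. *)
Definition local_ideal (f : 'I_r -> ratfun) (p : 'rV[K]_n) (q : ratfun) : Prop :=
  exists h : 'I_r -> ratfun,
    (forall i, regular_at p (h i)) /\ q = \sum_i h i * f i.

(* The local ring at p of the scheme f_1 = ... = f_r = 0 is the quotient of the
   local ring at p of the ambient space by [local_ideal f p]. It has dimension
   mu over K iff it has a basis of mu elements, namely the classes of regular
   functions e_1, ..., e_mu such that every element of the quotient is, in a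
   unique way, a K-linear combination of these classes. *)
Definition local_ring_dim (f : 'I_r -> ratfun) (p : 'rV[K]_n) (mu : nat) : Prop :=
  exists e : 'I_mu -> ratfun,
    (forall l, regular_at p (e l)) /\
    forall q, regular_at p q ->
      exists! c : 'rV[K]_mu,
        local_ideal f p (q - \sum_l constf (c 0 l) * e l).

End Multiplicity.

Section SparseSystem.
Variables (n N : nat).

(* The i-th Laurent polynomial with exponents a_j and coefficients c_ij,
   evaluated at a point x with coordinates in any field F: it is used below both
   at points of K^n and at the generic point (X_1, ..., X_n) of K(X)^n. *)
Definition sparse_eval (F : fieldType) (C : 'M[F]_(n, N))
    (a : 'I_N -> 'rV[int]_n) (x : 'rV[F]_n) (i : 'I_n) : F :=
  \sum_j C i j * \prod_l x 0 l ^ a j 0 l.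

Definition sparse_ratfun (K : fieldType) (C : 'M[K]_(n, N))
    (a : 'I_N -> 'rV[int]_n) (i : 'I_n) : ratfun K n :=
  sparse_eval (map_mx (@constf K n) C) a (\row_l polyf 'X_l) i.

Definition sparse_solutions (K : fieldType) (C : 'M[K]_(n, N))
    (a : 'I_N -> 'rV[int]_n) : set 'rV[K]_n :=
  [set x : 'rV[K]_n | (forall l, x 0 l != 0) /\ forall i, sparse_eval C a x i = 0]%classic.

(* The torus is open in K^n, so being isolated in the torus and in K^n is the
   same. *)
Definition sparse_isolated_mult (K : numFieldType) (C : 'M[K]_(n, N))
    (a : 'I_N -> 'rV[int]_n) (x : 'rV[K]_n) (mu : nat) : Prop :=
  isolated (sparse_solutions C a) x /\
  local_ring_dim (sparse_ratfun C a) x mu.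

Definition in_affine_hyperplane (R : realType) (a : 'I_N -> 'rV[int]_n) : Prop :=
  exists (u : 'rV[R]_n) (b : R),
    u != 0 /\ forall j, \sum_l u 0 l * (a j 0 l)%:~R = b.

Definition exponent_mx (a : 'I_N -> 'rV[int]_n) : 'M[int]_(1 + n, N) :=
  col_mx (const_mx 1) (\matrix_(l, j) a j 0 l).

End SparseSystem.

Definition int_gale_dual (k N m : nat)
    (A : 'M[int]_(k, N)) (B : 'M[int]_(N, m)) : Prop :=
  \rank (map_mx intr B : 'M[rat]_(N, m)) = m /\ A *m B = 0.

(* The columns of D form a basis of the right kernel of C. *)
Definition gale_dual (K : fieldType) (n N k : nat)
    (C : 'M[K]_(n, N)) (D : 'M[K]_(N, k)) : Prop :=
  C *m D = 0 /\
  forall v : 'cV[K]_N, C *m v = 0 -> exists! w : 'cV[K]_k, v = D *m w.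

Section GaleSystem.
Variables (N m : nat).

(* The rows of D are (1, delta_i). *)
Definition reduced (K : fieldType) (D : 'M[K]_(N.+1, 1 + m)) : Prop :=
  lsubmx D = const_mx 1 /\ row 0 (rsubmx D) = 0.

Definition gale_linear (K : fieldType) (D : 'M[K]_(N, 1 + m)) (i : 'I_N) :
    {mpoly K[m]} :=
  1 + \sum_j rsubmx D i j *: 'X_j.

Definition gale_poly (K : fieldType) (B : 'M[int]_(N, m))
    (D : 'M[K]_(N, 1 + m)) (k : 'I_m) : {mpoly K[m]} :=
  \prod_(i | 0 < B i k) gale_linear D i ^+ absz (B i k)
  - \prod_(i | B i k < 0) gale_linear D i ^+ absz (B i k).

Definition gale_solutions (K : fieldType) (B : 'M[int]_(N, m))
    (D : 'M[K]_(N, 1 + m)) : set 'rV[K]_m :=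
  [set y : 'rV[K]_m | forall k, (gale_poly B D k).@[y 0] = 0]%classic.

Definition gale_isolated_mult (K : numFieldType) (B : 'M[int]_(N, m))
    (D : 'M[K]_(N, 1 + m)) (y : 'rV[K]_m) (mu : nat) : Prop :=
  isolated (gale_solutions B D) y /\
  local_ring_dim (fun k => polyf (gale_poly B D k)) y mu.

End GaleSystem.

(* Main.v *)
Require Import Defs.
From HB Require Import structures.
From mathcomp Require Import all_boot all_order all_algebra fraction.
From mathcomp Require Import complex.
From mathcomp Require Import mpoly ring.
From mathcomp Require Import boolp classical_sets reals topology normedtype.
Import numFieldNormedType.Exports.

(** Write [O_T] for the local ring of the torus at the point 1 and [O_Y] for
    the local ring of affine m-space at the origin.  Put
    [z_j = x^(a_j - a_0)] in [O_T] and let [p_j = 1 + <delta_j, y>] in [O_Y].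
    Up to units the ideal of the sparse system is
    [I = (sum_j c_ij z_j)_i], and that of the Gale system is
    [J = (p^(B_k) - 1)_k], where [B_k] is the k-th column of B.  Both systems
    describe the germ at 1 of the intersection of the subgroup [z^B = 1] with the affine
    space [C z = 0, z_0 = 1]: x parametrizes the subgroup near 1, and y
    parametrizes the affine space.

    The algebraic form of this picture is a pair of homomorphisms.
    - From [O_Y] to [O_T]: modulo I the vector z - 1 lies in the span of the
      columns of D, so some linear forms in z - 1 can be substituted for y, and
      this sends [p_j] to [z_j] modulo I.  Then [p^(B_k)] goes to [z^(B_k) = 1].
    - From [O_T] to [O_Y]: choose an integer matrix M and d > 0 such that
      [sum_j (a_j - a_0)_l M_jl' = d] if [l = l'], and 0 otherwise.  One wants to
      send [x_l] to [prod_j p_j^(M_jl / d)].  The d-th roots of the [p_j] exist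
      only in the completion, but for every N they exist modulo the N-th power
      of the maximal ideal ([root_exists]), which suffices.
    In a local ring of characteristic zero an element of residue 1 is determined
    modulo any ideal by its d-th power ([root_unique]).  This is what makes the
    choice of B irrelevant: every integer vector v in the kernel of A has a
    multiple that is an integral combination of the columns of B, hence p^v is 1
    modulo J, even if the columns of B span a proper sublattice of the integral
    kernel.  It follows that the two homomorphisms are inverse to each other
    modulo I, J and the N-th powers of the maximal ideals
    ([gale_approx_iso]).

    If the quotient by I has dimension mu, then I contains the mu-th power of the
    maximal ideal ([codim_mpow]).  Carried through the homomorphisms with
    N = mu + 1 and combined with Nakayama's lemma, this shows that J contains the
    mu-th power of its maximal ideal too; then the two quotients are isomorphic
    ([codim_approx_iso]).

    Finally, a solution whose local ring has finite dimension is isolated: the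
    mu-th powers of the coordinate differences are combinations of the equations
    with coefficients that stay regular nearby ([codim_isolated]). *)

Set Implicit Arguments.
Unset Strict Implicit.
Unset Printing Implicit Defensive.

Import Order.TTheory GRing.Theory Num.Theory.
Local Open Scope ring_scope.

(** * Local rings of affine space *)

Lemma divr_sub (F : fieldType) (a b c d : F) : b != 0 -> d != 0 ->
  a / b - c / d = (a * d - c * b) / (b * d).
Proof. by move=> b0 d0; rewrite -mulNr addf_div // mulNr. Qed.

Section Subst.
Variables (K : fieldType) (n : nat) (p : 'rV[K]_n) (A : comNzRingType).
Variables (P : {rmorphism {mpoly K[n]} -> A}) (P_inj : injective P).
Hypothesis fracP : forall q : A,
  exists u v : {mpoly K[n]}, v.@[p 0] != 0 /\ q * P v = P u.
Variables (S : comUnitRingType) (f : {rmorphism K -> S}) (h : 'I_n -> S).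
Hypothesis h_unit : forall v : {mpoly K[n]},
  v.@[p 0] != 0 -> mmap f h v \is a GRing.unit.

Let is_subst (q : A) (s : S) := exists u v : {mpoly K[n]},
  [/\ v.@[p 0] != 0, q * P v = P u & s * mmap f h v = mmap f h u].

(* The value at q is chosen among the elements s that fit some fraction
   representing q; [substE] says that every such fraction gives the same s. *)
Let subst q := xget 0 [set s | is_subst q s]%classic.

Let substE q u v : v.@[p 0] != 0 -> q * P v = P u ->
  subst q * mmap f h v = mmap f h u.
Proof.
move=> v0 e; rewrite /subst; case: xgetP => [s _|].
  move=> [u' [v' [v0' e' es]]].
  apply: (mulIr (h_unit v0')); rewrite mulrAC es -!rmorphM /=.
  congr (mmap _ _ _); apply: P_inj; rewrite !rmorphM /= -e -e'.
  by rewrite mulrAC.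
move=> /(_ (mmap f h u / mmap f h v)) [] /=; exists u, v; split=> //.
by rewrite divrK // h_unit.
Qed.

Let subst_poly u : subst (P u) = mmap f h u.
Proof.
have V0 : (1 : {mpoly K[n]}).@[p 0] != 0 by rewrite meval1 oner_eq0.
by have := @substE (P u) u 1 V0; rewrite !rmorph1 !mulr1; apply.
Qed.

Lemma subst_rmorph : zmod_morphism subst * monoid_morphism subst.
Proof.
split; [move=> q q'|split; [|move=> q q']].
- have [u [v [v0 e]]] := fracP q; have [u' [v' [v0' e']]] := fracP q'.
  have V0 : (v * v').@[p 0] != 0 by rewrite mevalM mulf_neq0.
  have E : (q - q') * P (v * v') = P (u * v' - u' * v).
    by rewrite rmorphB !rmorphM /= -e -e'; ring.
  apply: (mulIr (h_unit V0)); rewrite (substE V0 E) mulrBl rmorphB !rmorphM /=.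
  by rewrite -(substE v0 e) -(substE v0' e'); ring.
- by rewrite -(rmorph1 P) subst_poly rmorph1.
- have [u [v [v0 e]]] := fracP q; have [u' [v' [v0' e']]] := fracP q'.
  have V0 : (v * v').@[p 0] != 0 by rewrite mevalM mulf_neq0.
  have E : (q * q') * P (v * v') = P (u * u').
    by rewrite !rmorphM /= -e -e'; ring.
  apply: (mulIr (h_unit V0)); rewrite (substE V0 E) !rmorphM /=.
  by rewrite -(substE v0 e) -(substE v0' e'); ring.
Qed.

(** Universal property of the localization, for any ring [A] whose elements
    are fractions of polynomials with denominators nonzero at [p]: a
    substitution of polynomials extends to [A] as soon as it makes these
    denominators invertible. *)
Lemma subst_exists :
  exists phi : {rmorphism A -> S}, forall u, phi (P u) = mmap f h u.
Proof.
pose b1 := GRing.isZmodMorphism.Build A S subst subst_rmorph.1.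
pose b2 := GRing.isMonoidMorphism.Build A S subst subst_rmorph.2.
pose phi : {rmorphism A -> S} := HB.pack subst b1 b2.
by exists phi => u; exact: subst_poly.
Qed.

End Subst.

Section LocalRing.
Variables (K : fieldType) (n : nat) (p : 'rV[K]_n).

Lemma polyf_eq0 (u : {mpoly K[n]}) : (polyf u == 0) = (u == 0).
Proof. exact: tofrac_eq0. Qed.

Lemma polyf_inj : injective (@polyf K n).
Proof. by move=> u v /eqP; rewrite tofrac_eq => /eqP. Qed.

HB.instance Definition _ := GRing.RMorphism.copy (@polyf K n)
  (@tofrac {mpoly K[n]}).

Lemma meval_neq0 (v : {mpoly K[n]}) (x : 'rV[K]_n) : v.@[x 0] != 0 -> v != 0.
Proof. by apply: contraNneq => ->; rewrite meval0. Qed.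

Definition regular : {pred ratfun K n} := fun q => `[< regular_at p q >].

Lemma regularP q : reflect (regular_at p q) (q \in regular).
Proof. exact: asboolP. Qed.

Lemma regular_subring : subring_closed regular.
Proof.
split.
- apply/regularP; exists 1, 1; rewrite meval1 oner_eq0; split=> //.
  by rewrite rmorph1 divr1.
- move=> _ _ /regularP[u [v [v0 ->]]] /regularP[u' [v' [v0' ->]]].
  apply/regularP; exists (u * v' - u' * v), (v * v'); split.
    by rewrite mevalM mulf_neq0.
  have nz : polyf v != 0 by rewrite polyf_eq0 (meval_neq0 v0).
  have nz' : polyf v' != 0 by rewrite polyf_eq0 (meval_neq0 v0').
  by rewrite (divr_sub _ _ nz nz') -!(rmorphM (@polyf K n)) -(rmorphB (@polyf K n)).
- move=> _ _ /regularP[u [v [v0 ->]]] /regularP[u' [v' [v0' ->]]].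
  apply/regularP; exists (u * u'), (v * v'); split.
    by rewrite mevalM mulf_neq0.
  by rewrite mulf_div -!(rmorphM (@polyf K n)).
Qed.

HB.instance Definition _ := GRing.isSubringClosed.Build (ratfun K n) regular
  regular_subring.

Record local_ring := LocalRing {germ : ratfun K n; germP : germ \in regular}.

HB.instance Definition _ := [isSub for germ].
HB.instance Definition _ := [Choice of local_ring by <:].
HB.instance Definition _ := [SubChoice_isSubComNzRing of local_ring by <:].

Lemma germ_rmorph : zmod_morphism germ * monoid_morphism germ.
Proof. by split; [exact: (raddfB val) | split; [exact: rmorph1 | exact: (rmorphM val)]]. Qed.

HB.instance Definition _ := GRing.isZmodMorphism.Build local_ring (ratfun K n)
  germ germ_rmorph.1.
HB.instance Definition _ := GRing.isMonoidMorphism.Build local_ring (ratfun K n)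
  germ germ_rmorph.2.

Lemma germ_inj : injective germ. Proof. exact: val_inj. Qed.

Lemma poly_regular (u : {mpoly K[n]}) : polyf u \in regular.
Proof.
apply/regularP; exists u, 1; rewrite meval1 oner_eq0; split=> //.
by rewrite rmorph1 divr1.
Qed.

Definition lpoly u := LocalRing (poly_regular u).

Lemma lpoly_rmorph : zmod_morphism lpoly * monoid_morphism lpoly.
Proof.
split; [|split] => [u v||u v]; apply: germ_inj.
- by rewrite (rmorphB germ) /= (rmorphB (@polyf K n)).
- by rewrite (rmorph1 germ) /= (rmorph1 (@polyf K n)).
- by rewrite (rmorphM germ) /= (rmorphM (@polyf K n)).
Qed.

HB.instance Definition _ := GRing.isZmodMorphism.Build {mpoly K[n]} local_ring
  lpoly lpoly_rmorph.1.
HB.instance Definition _ := GRing.isMonoidMorphism.Build {mpoly K[n]} local_ring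
  lpoly lpoly_rmorph.2.

Lemma germ_fracP (q : local_ring) :
  exists u v, v.@[p 0] != 0 /\ q * lpoly v = lpoly u.
Proof.
have /regularP[u [v [v0 e]]] := germP q; exists u, v; split=> //.
apply: germ_inj; rewrite rmorphM /= e divfK // polyf_eq0.
exact: meval_neq0 v0.
Qed.

End LocalRing.

Section Evaluation.
Variables (K : fieldType) (n : nat) (p : 'rV[K]_n).
Notation O := (local_ring p).

Lemma lpoly_inj : injective (lpoly p).
Proof. by move=> u v /(congr1 (@germ _ _ _)) /polyf_inj. Qed.

Fact ev_unit (v : {mpoly K[n]}) : v.@[p 0] != 0 ->
  mmap idfun (p 0) v \is a GRing.unit.
Proof. by rewrite unitfE. Qed.

Fact lev_exists :
  {phi : {rmorphism O -> K} | forall u, phi (lpoly p u) = u.@[p 0]}.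
Proof. exact/cid/(subst_exists lpoly_inj (@germ_fracP K n p) ev_unit). Qed.

Definition lev : {rmorphism O -> K} := sval lev_exists.

Lemma lev_poly u : lev (lpoly p u) = u.@[p 0].
Proof. exact: svalP lev_exists u. Qed.

Definition linv (q : O) : O :=
  if lev q != 0 then insubd q (germ q)^-1 else q.

Lemma germ_linv q : lev q != 0 -> germ (linv q) = (germ q)^-1.
Proof.
have [u [v [v0 e]]] := germ_fracP q.
have := congr1 lev e; rewrite rmorphM /= !lev_poly => e1 q0.
have u0 : u.@[p 0] != 0 by rewrite -e1 mulf_neq0.
have /(congr1 (@germ _ _ _)) := e; rewrite rmorphM /= => e2.
rewrite /linv q0 insubdK //; apply/regularP; exists v, u; split=> //.
rewrite -e2 invfM mulrCA divff ?mulr1 //.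
by rewrite polyf_eq0 (meval_neq0 v0).
Qed.

Definition lunit : {pred O} := fun q => lev q != 0.

Fact lmulVr : {in lunit, left_inverse 1 linv *%R}.
Proof.
move=> q; rewrite unfold_in => q0; apply: germ_inj.
rewrite rmorphM rmorph1 /= germ_linv // mulVf //.
by apply: contraNneq q0 => e; rewrite (_ : q = 0) ?rmorph0 //; apply: germ_inj.
Qed.

Fact lunitP (x y : O) : y * x = 1 -> lunit x.
Proof.
move=> /(congr1 lev); rewrite rmorphM rmorph1 /= => e; rewrite /lunit.
by apply: contra_eqN e => /eqP ->; rewrite mulr0 eq_sym oner_eq0.
Qed.

Fact linv_out : {in [predC lunit], linv =1 id}.
Proof. by move=> q; rewrite inE /= /linv => /negPf; rewrite unfold_in /= => ->. Qed.

HB.instance Definition _ := GRing.ComNzRing_hasMulInverse.Build O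
  lmulVr lunitP linv_out.

Fact lunitE (q : O) : (q \is a GRing.unit) = (lev q != 0).
Proof. by []. Qed.

End Evaluation.

(** The characteristic properties of the local ring at [p].  All further
    arguments use only these, so that nothing computes in the field of
    fractions. *)
Record local_alg (K : fieldType) (n : nat) (p : 'rV[K]_n) := LocalAlg {
  lcar :> comUnitRingType;
  lgerm : {rmorphism lcar -> ratfun K n};
  lpol : {rmorphism {mpoly K[n]} -> lcar};
  lval : {rmorphism lcar -> K};
  lgerm_inj : injective lgerm;
  lgerm_im : forall q, regular_at p q <-> exists x, lgerm x = q;
  lgerm_pol : forall u, lgerm (lpol u) = polyf u;
  lval_pol : forall u, lval (lpol u) = u.@[p 0];
  lcar_unit : forall x : lcar, (x \is a GRing.unit) = (lval x != 0) }.

Lemma local_alg_exists (K : fieldType) (n : nat) (p : 'rV[K]_n) :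
  inhabited (local_alg p).
Proof.
apply: inhabits; apply: (@LocalAlg _ _ _ (local_ring p) (@germ _ _ p)
  (@lpoly _ _ p) (@lev _ _ p)).
- exact: germ_inj.
- move=> q; split=> [/regularP qr|[x <-]]; first by exists (LocalRing qr).
  exact/regularP/germP.
- by [].
- exact: lev_poly.
- exact: lunitE.
Qed.

(** * Ideals and congruences *)

Section Ideals.
Variable A : comNzRingType.

Definition is_ideal (J : A -> Prop) :=
  [/\ J 0, forall x y, J x -> J y -> J (x + y) & forall a x, J x -> J (a * x)].

Definition generated r (g : 'I_r -> A) (x : A) := exists h, x = \sum_i h i * g i.

Definition ideal_sum (I J : A -> Prop) (x : A) :=
  exists y z, [/\ I y, J z & x = y + z].

(** The k-th power of the ideal generated by [t]. *)
Fixpoint mpow r (t : 'I_r -> A) k x : Prop :=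
  if k is k'.+1 then
    exists h : 'I_r -> A, (forall l, mpow t k' (h l)) /\ x = \sum_l h l * t l
  else True.

Lemma generated_ideal r (g : 'I_r -> A) : is_ideal (generated g).
Proof.
split=> [|_ _ [h ->] [k ->]|a _ [h ->]].
- by exists (fun=> 0); rewrite big1 // => i _; rewrite mul0r.
- by exists (fun i => h i + k i); rewrite -big_split; apply: eq_bigr => i _; rewrite mulrDl.
- by exists (fun i => a * h i); rewrite mulr_sumr; apply: eq_bigr => i _; rewrite mulrA.
Qed.

Lemma generated_gen r (g : 'I_r -> A) i : generated g (g i).
Proof.
exists (fun j => (j == i)%:R); rewrite (bigD1 i) //= eqxx mul1r big1 ?addr0 //.
by move=> j /negPf ->; rewrite mul0r.
Qed.

Lemma ideal_sum_ideal I J : is_ideal I -> is_ideal J -> is_ideal (ideal_sum I J).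
Proof.
move=> [I0 ID IM] [J0 JD JM]; split=> [|_ _ [y [z [Iy Jz ->]]] [y' [z' [Iy' Jz' ->]]]|a _ [y [z [Iy Jz ->]]]].
- by exists 0, 0; rewrite addr0.
- by exists (y + y'), (z + z'); split; [exact: ID|exact: JD|rewrite addrACA].
- by exists (a * y), (a * z); split; [exact: IM|exact: JM|rewrite mulrDr].
Qed.

Lemma ideal_suml (I J : A -> Prop) x : is_ideal J -> I x -> ideal_sum I J x.
Proof. by move=> [J0 _ _] Ix; exists x, 0; rewrite addr0. Qed.

Lemma ideal_sumr (I J : A -> Prop) x : is_ideal I -> J x -> ideal_sum I J x.
Proof. by move=> [I0 _ _] Jx; exists 0, x; rewrite add0r. Qed.

Lemma mpow_ideal r (t : 'I_r -> A) k : is_ideal (mpow t k).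
Proof.
elim: k => [|k [M0 MD MM]] //; split=> /= [|_ _ [h [hP ->]] [g [gP ->]]|a _ [h [hP ->]]].
- by exists (fun=> 0); split=> //; rewrite big1 // => i _; rewrite mul0r.
- exists (fun i => h i + g i); split=> [l|]; first exact: MD.
  by rewrite -big_split; apply: eq_bigr => i _; rewrite mulrDl.
- exists (fun i => a * h i); split=> [l|]; first exact: MM.
  by rewrite mulr_sumr; apply: eq_bigr => i _; rewrite mulrA.
Qed.

Lemma mpowS r (t : 'I_r -> A) k x : mpow t k.+1 x -> mpow t k x.
Proof.
elim: k x => [|k IH] x // [h [hP ->]]; exists h; split=> // l.
exact: IH.
Qed.

Lemma mpow_mul r (t : 'I_r -> A) k x y :
  generated t x -> mpow t k y -> mpow t k.+1 (x * y).
Proof.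
move=> [h ->] My; exists (fun l => h l * y); split=> [l|].
  by have [_ _ MM] := mpow_ideal t k; exact: MM.
by rewrite mulr_suml; apply: eq_bigr => l _; rewrite mulrAC.
Qed.

(** The factor [a] makes the induction on [k] go through, by absorbing one
    generator at each step. *)
Lemma mpow_prod r (t : 'I_r -> A) k (I : A -> Prop) (a x : A) :
  is_ideal I -> (forall s, size s = k -> I (a * \prod_(l <- s) t l)) ->
  mpow t k x -> I (a * x).
Proof.
move=> [I0 ID IM]; elim: k a x => [|k IH] a x Hs /=.
  by move=> _; have := Hs [::] erefl; rewrite big_nil mulr1 mulrC; exact: IM.
move=> [h [hP ->]]; rewrite mulr_sumr; apply: (big_ind I) => // l _.
rewrite mulrA mulrAC; apply: IH (hP l) => s ss.
by have := Hs (l :: s); rewrite big_cons /= ss mulrA; apply.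
Qed.

Lemma mpow_fg r (t : 'I_r -> A) k : exists (T : finType) (w : T -> A),
  forall x, mpow t k x <-> exists h, x = \sum_i h i * w i.
Proof.
elim: k => [|k [T [w IH]]].
  exists unit, (fun=> 1) => x; split=> // _; exists (fun=> x).
  by rewrite (bigD1 tt) //= big1 ?addr0 ?mulr1 // => -[].
exists ('I_r * T)%type, (fun i => w i.2 * t i.1) => x; split=> [[h [hP ->]]|[h ->]].
  have /choice[g gP] l : exists g, h l = \sum_i g i * w i by exact/IH/hP.
  exists (fun i => g i.1 i.2); rewrite -(pair_bigA _ (fun l i => g l i * (w i * t l))) /=.
  by apply: eq_bigr => l _; rewrite gP mulr_suml; apply: eq_bigr => i _; rewrite mulrA.
have -> : \sum_i h i * (w i.2 * t i.1) = \sum_l \sum_i h (l, i) * (w i * t l).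
  by rewrite pair_bigA; apply: eq_bigr => -[].
exists (fun l => \sum_i h (l, i) * w i); split=> [l|]; first by apply/IH; eexists.
by apply: eq_bigr => l _; rewrite mulr_suml; apply: eq_bigr => i _; rewrite mulrA.
Qed.

Section Congruence.
Variables (J : A -> Prop) (idJ : is_ideal J).

Definition cong x y := J (x - y).

Lemma congxx x : cong x x.
Proof. by case: idJ => ? _ _; rewrite /cong subrr. Qed.

Lemma cong_sym x y : cong x y -> cong y x.
Proof. by case: idJ => _ _ JM /(JM (-1)); rewrite mulN1r opprB. Qed.

Lemma cong_trans y x z : cong x y -> cong y z -> cong x z.
Proof. by case: idJ => _ JD _ xy /(JD _ _ xy); rewrite addrA subrK. Qed.

Lemma congD x y x' y' : cong x y -> cong x' y' -> cong (x + x') (y + y').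
Proof.
case: idJ => _ JD _ xy /(JD _ _ xy) h; rewrite /cong.
by rewrite opprD addrACA.
Qed.

Lemma congMl a x y : cong x y -> cong (a * x) (a * y).
Proof. by case: idJ => _ _ JM xy; rewrite /cong -mulrBr; apply: JM. Qed.

Lemma congM x y x' y' : cong x y -> cong x' y' -> cong (x * x') (y * y').
Proof.
move=> xy xy'; apply: (@cong_trans (x * y')); first exact: congMl.
by rewrite ![_ * y']mulrC; exact: congMl.
Qed.

Lemma congX k x y : cong x y -> cong (x ^+ k) (y ^+ k).
Proof.
move=> xy; elim: k => [|k IH]; first by rewrite !expr0; exact: congxx.
by rewrite !exprS; exact: congM.
Qed.

Lemma cong_sum (T : Type) (s : seq T) (F G : T -> A) :
  (forall i, cong (F i) (G i)) -> cong (\sum_(i <- s) F i) (\sum_(i <- s) G i).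
Proof.
move=> FG; apply: (big_ind2 cong) => //; first exact: congxx.
by move=> *; exact: congD.
Qed.

Lemma cong_prod (T : Type) (s : seq T) (P : pred T) (F G : T -> A) :
  (forall i, P i -> cong (F i) (G i)) ->
  cong (\prod_(i <- s | P i) F i) (\prod_(i <- s | P i) G i).
Proof.
move=> FG; apply: (big_ind2 cong) => //; first exact: congxx.
by move=> *; exact: congM.
Qed.

Lemma cong_ideal x y : cong x y -> J y -> J x.
Proof. by case: idJ => _ JD _ xy Jy; have := JD _ _ xy Jy; rewrite subrK. Qed.

(** Congruent arguments give congruent values of a polynomial.  This is used
    both to compare homomorphisms and, for constant arguments, to see that the
    parameters generate the maximal ideal. *)
Lemma mmap_cong (K : nzRingType) n (f : K -> A) (h h' : 'I_n -> A) (u : {mpoly K[n]}) :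
  (forall l, cong (h l) (h' l)) -> cong (mmap f h u) (mmap f h' u).
Proof.
move=> hh; apply: cong_sum => m; apply: congMl; apply: cong_prod => l _.
exact: congX.
Qed.

End Congruence.
End Ideals.

Lemma mpow_map (A B : comNzRingType) r s (t : 'I_r -> A) (t' : 'I_s -> B)
    (phi : {rmorphism A -> B}) k x :
  (forall l, generated t' (phi (t l))) -> mpow t k x -> mpow t' k (phi x).
Proof.
move=> tt'; elim: k x => [|k IH] x //= [h [hP ->]].
rewrite rmorph_sum; have [M0 MD MM] := mpow_ideal t' k.+1.
apply: (big_ind (mpow t' k.+1)) => // l _; rewrite rmorphM mulrC.
by apply: mpow_mul => //; exact: IH.
Qed.

Lemma generated_map (A B : comNzRingType) r (g : 'I_r -> A) (J : B -> Prop)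
    (phi : {rmorphism A -> B}) x : is_ideal J ->
  (forall i, J (phi (g i))) -> generated g x -> J (phi x).
Proof.
move=> [J0 JD JM] gJ [h ->]; rewrite rmorph_sum; apply: (big_ind J) => // l _.
by rewrite rmorphM; exact: JM.
Qed.

Definition has_codim (K A : nzRingType) (cst : K -> A) (I : A -> Prop) mu :=
  exists e : 'I_mu -> A, forall q, exists! c : 'rV[K]_mu,
    I (q - \sum_l cst (c 0 l) * e l).

Section LocalAlg.
Variables (K : fieldType) (n : nat) (p : 'rV[K]_n) (O : local_alg p).

Definition lcst : K -> O := @lpol K n p O \o @mpolyC n K.
HB.instance Definition _ := GRing.RMorphism.on lcst.

Definition lvar l : O := lpol O 'X_l.

(** The local parameters, that is, the generators of the maximal ideal. *)
Definition lpar l : O := lvar l - lcst (p 0 l).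

Lemma lval_cst c : lval O (lcst c) = c.
Proof. by rewrite /= lval_pol mevalC. Qed.

Lemma lval_var l : lval O (lvar l) = p 0 l.
Proof. by rewrite lval_pol mevalXU. Qed.

Lemma lpol_mmap u : lpol O u = mmap lcst lvar u.
Proof.
rewrite [in LHS](mpolyE u) rmorph_sum; apply: eq_bigr => m _.
rewrite -mul_mpolyC rmorphM; congr (_ * _).
by rewrite mpolyXE_id rmorph_prod; apply: eq_bigr => i _; rewrite rmorphXn.
Qed.

Lemma local_fracP (q : O) :
  exists u v, v.@[p 0] != 0 /\ q * lpol O v = lpol O u.
Proof.
have [|u [v [v0 e]]] := (lgerm_im O (lgerm O q)).2; first by exists q.
exists u, v; split=> //; apply: (@lgerm_inj _ _ _ O); rewrite rmorphM /= !lgerm_pol e.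
by rewrite divfK // polyf_eq0 (meval_neq0 v0).
Qed.

Lemma lvalP x : lval O x = 0 <-> generated lpar x.
Proof.
split=> [x0|[h ->]]; last first.
  rewrite rmorph_sum big1 // => l _.
  by rewrite rmorphM rmorphB /= lval_var lval_cst subrr mulr0.
have [u [v [v0 e]]] := local_fracP x.
have u0 : u.@[p 0] = 0.
  by have := congr1 (lval O) e; rewrite rmorphM /= !lval_pol x0 mul0r.
have vu : lpol O v \is a GRing.unit by rewrite lcar_unit lval_pol.
have [S0 SD SM] := generated_ideal lpar.
rewrite -[x](mulrK vu) e mulrC; apply: (SM); rewrite -[lpol O u]subr0.
have -> : 0 = mmap lcst (fun l => lcst (p 0 l)) u :> O.
  rewrite -(rmorph0 lcst) -u0 mevalE rmorph_sum; apply: eq_bigr => m _.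
  by rewrite rmorphM rmorph_prod; congr (_ * _); apply: eq_bigr => i _; rewrite rmorphXn.
rewrite lpol_mmap; apply: (mmap_cong (generated_ideal lpar)) => l.
exact: generated_gen.
Qed.

(** The determinant trick: the relations say that the matrix 1 - c maps the
    column of the w to a column with entries in I, and its determinant has
    residue 1. *)
Lemma nakayama (T : finType) (w : T -> O) (I : O -> Prop) : is_ideal I ->
  (forall i, exists c : T -> O, (forall j, lval O (c j) = 0) /\
     I (w i - \sum_j c j * w j)) ->
  forall i, I (w i).
Proof.
move=> idI /choice[c cP] i; have [I0 ID IM] := idI.
pose M : 'M[O]_#|T| := 1 - \matrix_(i, j) c (enum_val i) (enum_val j).
pose W : 'cV[O]_#|T| := \col_i w (enum_val i).
have MW j : I ((M *m W) j 0).
  rewrite mulmxBl mul1mx !mxE; have [_] := cP (enum_val j).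
  congr (I (_ - _)); rewrite (reindex_onto enum_val enum_rank) /=; last first.
    by move=> k _; rewrite enum_rankK.
  by apply: eq_big => [k|k _]; rewrite ?enum_valK ?eqxx // !mxE.
have detM : \det M \is a GRing.unit.
  rewrite lcar_unit -det_map_mx (_ : map_mx _ _ = 1) ?det1 ?oner_eq0 //.
  apply/matrixP => j k; rewrite !mxE rmorphB /= (cP _).1 subr0.
  by rewrite rmorph_nat.
have E : \det M *: W = \adj M *m (M *m W).
  by rewrite mulmxA mul_adj_mx mul_scalar_mx.
rewrite -(enum_rankK i).
have -> : w (enum_val (enum_rank i)) = (\det M)^-1 * (\det M *: W) (enum_rank i) 0.
  by rewrite !mxE mulKr.
apply: (IM); rewrite E mxE; apply: (big_ind I) => // j _; exact: IM.
Qed.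

(** Nakayama's lemma applied to the k-th power of the maximal ideal modulo
    [I]. *)
Lemma mpow_nakayama I k : is_ideal I ->
  (forall x, mpow lpar k x -> ideal_sum I (mpow lpar k.+1) x) ->
  forall x, mpow lpar k x -> I x.
Proof.
move=> idI H; have [T [w wP]] := mpow_fg lpar k; have [I0 ID IM] := idI.
have wI i : I (w i).
  apply: (nakayama (w := w) idI) => {}i.
  have wi : mpow lpar k (w i).
    apply/wP; exists (fun j => (j == i)%:R); rewrite (bigD1 i) //= eqxx mul1r big1 ?addr0 //.
    by move=> j /negPf ->; rewrite mul0r.
  have [y [_ [Iy [h [hP ->]] ->]]] := H _ wi.
  have /choice[g gP] l : exists g, h l = \sum_i g i * w i by exact/wP/hP.
  exists (fun j => \sum_l g l j * lpar l); split=> [j|].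
    by apply/lvalP; exists (fun l => g l j).
  suff -> : \sum_l h l * lpar l = \sum_j (\sum_l g l j * lpar l) * w j.
    by rewrite addrK.
  under [RHS]eq_bigr do rewrite mulr_suml.
  rewrite exchange_big; apply: eq_bigr => l _; rewrite gP mulr_suml.
  by apply: eq_bigr => j _; rewrite mulrAC.
by move=> x /wP[h ->]; apply: (big_ind I) => // j _; exact: IM.
Qed.

(** Let [t_1, ..., t_mu] be parameters.  The mu + 1 partial products
    [t_1 ... t_i] are linearly dependent modulo I, and in a linear relation the
    first partial product with a nonzero coefficient can be factored out, which
    leaves a unit: that partial product, hence the full one, lies in I. *)
Lemma codim_mpow I mu : is_ideal I -> has_codim lcst I mu ->
  forall x, mpow lpar mu x -> I x.
Proof.
move=> idI [e eP] x Mx; have [I0 ID IM] := idI.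
rewrite -[x]mul1r; apply: mpow_prod Mx => // s ss; rewrite mul1r.
have /choice[c cP] q : exists c : 'rV[K]_mu, I (q - \sum_l lcst (c 0 l) * e l).
  by have [c [cP _]] := eP q; exists c.
pose w i := \prod_(l <- take i s) lpar l.
pose M : 'M[K]_(mu.+1, mu) := \matrix_(i, j) c (w i) 0 j.
have /rowV0Pn[v /sub_kermxP vM v0] : kermx M != 0.
  rewrite -mxrank_eq0 mxrank_ker -lt0n subn_gt0 ltnS.
  exact: rank_leq_col.
have Iv : I (\sum_i lcst (v 0 i) * w i).
  have : cong I (\sum_i lcst (v 0 i) * w i)
      (\sum_i lcst (v 0 i) * (\sum_l lcst (M i l) * e l)).
    apply: cong_sum => // i; apply: congMl => //.
    rewrite /cong; have := cP (w i); congr (I (_ - _)).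
    by apply: eq_bigr => l _; rewrite mxE.
  move=> /cong_ideal; apply=> //.
  under eq_bigr do rewrite mulr_sumr.
  rewrite exchange_big big1 // => l _.
  under eq_bigr do rewrite mulrA -rmorphM.
  rewrite -mulr_suml -rmorph_sum.
  have /matrixP/(_ 0 l) := vM; rewrite !mxE => ->.
  by rewrite rmorph0 mul0r.
have {v0} [i vi0] : exists i, v 0 i != 0 by apply/rV0Pn.
(* Horner's scheme: as long as the leading coefficient u 0 is zero a parameter
   is moved into the factor a; otherwise the sum is a unit. *)
have key : forall (s : seq 'I_n) (u : nat -> K) (a : O),
    (exists2 i, (i <= size s)%N & u i != 0) ->
    I (a * \sum_(i < (size s).+1) lcst (u i) * \prod_(l <- take i s) lpar l) ->
    I (a * \prod_(l <- s) lpar l).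
  elim=> [|l s0 IH] u a [k ks uk].
    move: ks; rewrite leqn0 => /eqP k0; rewrite k0 in uk.
    rewrite /= big_ord_recl big_ord0 addr0 !big_nil !mulr1 mulrC => /(IM (lcst (u 0)^-1)).
    by rewrite mulrA -rmorphM mulVf // rmorph1 mul1r.
  rewrite big_ord_recl /= big_nil mulr1.
  rewrite (_ : \sum_(i < _) _ =
    lpar l * \sum_(i < (size s0).+1) lcst (u i.+1) * \prod_(l <- take i s0) lpar l); last first.
    rewrite mulr_sumr; apply: eq_bigr => j _.
    by rewrite big_cons mulrCA.
  set S := \sum_(_ < _) _; have [u0|u0] := eqVneq (u 0) 0; last first.
    have S0 : lcst (u 0) + lpar l * S \is a GRing.unit.
      rewrite lcar_unit rmorphD rmorphM /= lval_cst.
      have /lvalP -> := generated_gen lpar l.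
      by rewrite mul0r addr0.
    move=> /(IM (lcst (u 0) + lpar l * S)^-1); rewrite mulrCA mulVr // mulr1.
    by rewrite mulrC; exact: IM.
  rewrite u0 rmorph0 add0r mulrA big_cons mulrA; apply: (IH (fun i => u i.+1)).
  by case: k ks uk => [|k] ks uk; [rewrite u0 eqxx in uk|exists k].
rewrite -[X in I X]mul1r; apply: (key s (fun i => v 0 (inord i))).
  by exists i; [rewrite ss -ltnS|rewrite inord_val].
rewrite mul1r ss; move: Iv; congr I; apply: eq_bigr => j _.
by rewrite inord_val.
Qed.

(** A homomorphism over K is determined modulo any ideal by the images of the
    variables, since congruent units have congruent inverses. *)
Lemma rmorph_eq_cong (B : comUnitRingType) (J : B -> Prop)
    (phi psi : {rmorphism O -> B}) : is_ideal J ->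
  (forall c, phi (lcst c) = psi (lcst c)) ->
  (forall l, cong J (phi (lvar l)) (psi (lvar l))) ->
  forall q, cong J (phi q) (psi q).
Proof.
move=> idJ eqC eqX q; have [u [v [v0 e]]] := local_fracP q.
have pol u0 : cong J (phi (lpol O u0)) (psi (lpol O u0)).
  have mm (xi : {rmorphism O -> B}) :
      xi (lpol O u0) = mmap (xi \o lcst) (xi \o lvar) u0.
    rewrite lpol_mmap rmorph_sum; apply: eq_bigr => m _; rewrite rmorphM rmorph_prod.
    by congr (_ * _); apply: eq_bigr => i _; rewrite rmorphXn.
  rewrite !mm (_ : mmap (psi \o lcst) _ _ = mmap (phi \o lcst) (psi \o lvar) u0).
    exact: mmap_cong.
  by apply: eq_bigr => m _; rewrite /= eqC.
have vu : lpol O v \is a GRing.unit by rewrite lcar_unit lval_pol.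
rewrite -[q](mulrK vu) e !rmorphM; apply: congM => //.
have [_ _ JM] := idJ; have := cong_sym idJ (pol v).
move=> /(JM (phi (lpol O v)^-1 * psi (lpol O v)^-1)); congr J.
have e1 : phi (lpol O v)^-1 * phi (lpol O v) = 1 by rewrite -rmorphM mulVr ?rmorph1.
have e2 : psi (lpol O v)^-1 * psi (lpol O v) = 1 by rewrite -rmorphM mulVr ?rmorph1.
by rewrite mulrBr -mulrA e2 mulr1 mulrAC e1 mul1r.
Qed.

End LocalAlg.

(** * Homomorphisms of local rings and transfer of the dimension *)

Section Homs.
Variables (K : fieldType) (n1 n2 : nat) (p1 : 'rV[K]_n1) (p2 : 'rV[K]_n2).
Variables (O1 : local_alg p1) (O2 : local_alg p2).

(** Homomorphisms over K are automatically local: the difference of x and the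
    residue of its image maps to a nonunit, so it is not a unit. *)
Lemma lval_hom (phi : {rmorphism O1 -> O2}) :
  (forall c, phi (lcst O1 c) = lcst O2 c) -> forall x, lval O2 (phi x) = lval O1 x.
Proof.
move=> phiC x; apply/eqP; rewrite -subr_eq0; apply/negPn/negP => ne.
have : phi (x - lcst O1 (lval O2 (phi x))) \is a GRing.unit.
  by apply: rmorph_unit; rewrite lcar_unit rmorphB /= lval_cst -opprB oppr_eq0.
by rewrite lcar_unit !rmorphB /= phiC lval_cst subrr eqxx.
Qed.

Lemma hom_mpow (phi : {rmorphism O1 -> O2}) k x :
  (forall c, phi (lcst O1 c) = lcst O2 c) ->
  mpow (@lpar _ _ _ O1) k x -> mpow (@lpar _ _ _ O2) k (phi x).
Proof.
move=> phiC; apply: mpow_map => l; apply/lvalP; rewrite lval_hom //.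
by apply/lvalP; exact: generated_gen.
Qed.

Lemma hom_exists (h : 'I_n1 -> O2) : (forall l, lval O2 (h l) = p1 0 l) ->
  exists phi : {rmorphism O1 -> O2},
    (forall c, phi (lcst O1 c) = lcst O2 c) /\ forall l, phi (lvar O1 l) = h l.
Proof.
move=> hp.
have lpol_inj : injective (lpol O1).
  by move=> u v /(congr1 (lgerm O1)); rewrite !lgerm_pol => /polyf_inj.
have hU (v : {mpoly K[n1]}) : v.@[p1 0] != 0 -> mmap (lcst O2) h v \is a GRing.unit.
  rewrite lcar_unit => v0; rewrite (_ : lval O2 _ = v.@[p1 0]) //.
  rewrite mevalE rmorph_sum; apply: eq_bigr => u _; rewrite rmorphM /= lval_cst.
  by congr (_ * _); rewrite rmorph_prod; apply: eq_bigr => i _; rewrite rmorphXn /= hp.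
have [phi phiP] := subst_exists lpol_inj (@local_fracP _ _ _ O1) hU.
exists phi; split=> [c|l]; first by rewrite /= phiP mmapC.
by rewrite phiP mmapX mmap1U.
Qed.

End Homs.

Section Transfer.
Variable K : fieldType.

(** The quotients by [I1] and [I2] become isomorphic after reduction modulo the
    N-th powers of the maximal ideals.  The isomorphisms may depend on N and
    lift to the local rings themselves. *)
Definition approx_iso n1 n2 (p1 : 'rV[K]_n1) (p2 : 'rV[K]_n2)
    (O1 : local_alg p1) (O2 : local_alg p2) (I1 : O1 -> Prop) (I2 : O2 -> Prop) :=
  forall N, let J1 := ideal_sum I1 (mpow (@lpar _ _ _ O1) N) in
    let J2 := ideal_sum I2 (mpow (@lpar _ _ _ O2) N) in
  exists (phi : {rmorphism O1 -> O2}) (psi : {rmorphism O2 -> O1}),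
  [/\ (forall c, phi (lcst O1 c) = lcst O2 c) /\ forall c, psi (lcst O2 c) = lcst O1 c,
      forall x, I1 x -> J2 (phi x), forall x, I2 x -> J1 (psi x),
      forall x, cong J1 (psi (phi x)) x & forall x, cong J2 (phi (psi x)) x].

Lemma approx_iso_sym n1 n2 (p1 : 'rV[K]_n1) (p2 : 'rV[K]_n2)
    (O1 : local_alg p1) (O2 : local_alg p2) (I1 : O1 -> Prop) (I2 : O2 -> Prop) :
  approx_iso I1 I2 -> approx_iso I2 I1.
Proof.
by move=> H N; have [phi [psi [[? ?] ? ? ? ?]]] := H N; exists psi, phi; split.
Qed.

(** The mu-th power [m1^mu] of the first maximal ideal lies in I1.  Mapping
    [m2^mu] into it and back gives that [m2^mu] lies in [I2 + m2^(mu+1)], hence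
    in I2 by Nakayama.  For N = mu + 1 the approximate isomorphism is therefore
    an isomorphism of the quotients by I1 and I2, which carries a basis to a
    basis. *)
Lemma codim_approx_iso n1 n2 (p1 : 'rV[K]_n1) (p2 : 'rV[K]_n2)
    (O1 : local_alg p1) (O2 : local_alg p2) (I1 : O1 -> Prop) (I2 : O2 -> Prop) mu :
  is_ideal I1 -> is_ideal I2 -> approx_iso I1 I2 ->
  has_codim (lcst O1) I1 mu -> has_codim (lcst O2) I2 mu.
Proof.
move=> id1 id2 iso cod1; have m1 := codim_mpow id1 cod1.
have [phi [psi [[phiC psiC] phiI psiI psiphi phipsi]]] := iso mu.+1.
have J1I x : ideal_sum I1 (mpow (@lpar _ _ _ O1) mu.+1) x -> I1 x.
  case: id1 => _ ID _ [y [z [Iy Mz ->]]]; apply: ID => //; apply: m1.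
  exact: mpowS.
have m2 : forall x, mpow (@lpar _ _ _ O2) mu x -> I2 x.
  apply: mpow_nakayama => // x Mx.
  apply: (cong_ideal _ (cong_sym _ (phipsi x))).
  - exact: (ideal_sum_ideal id2 (mpow_ideal _ _)).
  - exact: (ideal_sum_ideal id2 (mpow_ideal _ _)).
  apply: phiI; apply: m1; exact: hom_mpow.
have J2I x : ideal_sum I2 (mpow (@lpar _ _ _ O2) mu.+1) x -> I2 x.
  case: id2 => _ ID _ [y [z [Iy Mz ->]]]; apply: ID => //; apply: m2.
  exact: mpowS.
have [e eP] := cod1; exists (phi \o e) => q.
have [c [cP cU]] := eP (psi q); exists c; split=> [|c' c'P].
  have := J2I _ (phiI _ cP); rewrite rmorphB rmorph_sum.
  have -> : \sum_i phi (lcst O1 (c 0 i) * e i) =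
            \sum_l lcst O2 (c 0 l) * (phi \o e) l.
    by apply: eq_bigr => l _; rewrite rmorphM phiC.
  have qq := cong_sym id2 (J2I _ (phipsi q)).
  exact: (cong_trans id2 qq).
apply: cU; have := J1I _ (psiI _ c'P); rewrite rmorphB rmorph_sum => h.
apply: (cong_trans id1 h); apply: cong_sum => // l.
rewrite rmorphM psiC; apply: congMl => //; exact: J1I (psiphi (e l)).
Qed.

End Transfer.

Section Roots.
Variables (K : numFieldType) (n : nat) (p : 'rV[K]_n) (O : local_alg p).

(** The quotient of x^d - y^d by x - y has residue d, so it is a unit. *)
Lemma root_unique (J : O -> Prop) d x y : is_ideal J -> (0 < d)%N ->
  lval O x = 1 -> lval O y = 1 -> cong J (x ^+ d) (y ^+ d) -> cong J x y.
Proof.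
move=> [_ _ JM] d0 x1 y1; rewrite /cong subrXX; set S := \sum_(_ < _) _.
have uS : S \is a GRing.unit.
  rewrite lcar_unit rmorph_sum (eq_bigr (fun=> 1)) => [|i _].
    by rewrite sumr_const card_ord pnatr_eq0 -lt0n.
  by rewrite rmorphM !rmorphXn /= x1 y1 !expr1n mulr1.
by move=> /(JM S^-1); rewrite mulrC -mulrA mulrV // mulr1.
Qed.

(** Newton's method: the correction (x - y^d) / d improves a root modulo the
    N-th power of the maximal ideal to one modulo the next power, because the
    quotient of (y + eps)^d - y^d by eps has residue d. *)
Lemma root_exists N d x : (0 < d)%N -> lval O x = 1 ->
  exists y, lval O y = 1 /\ cong (mpow (@lpar _ _ _ O) N) (y ^+ d) x.
Proof.
move=> d0 x1; elim: N => [|N [y [y1 yx]]]; first by exists 1; rewrite rmorph1.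
have dn0 : d%:R != 0 :> K by rewrite pnatr_eq0 -lt0n.
pose eps := lcst O d%:R^-1 * (x - y ^+ d).
have eps0 : lval O eps = 0.
  by rewrite rmorphM rmorphB rmorphXn /= x1 y1 expr1n subrr mulr0.
have epsN : mpow (@lpar _ _ _ O) N eps.
  have [_ _ MM] := mpow_ideal (@lpar _ _ _ O) N; apply: MM.
  exact: (cong_sym (mpow_ideal (@lpar _ _ _ O) N) yx).
exists (y + eps); split; first by rewrite rmorphD /= y1 eps0 addr0.
rewrite /cong.
pose S := \sum_(i < d) (y + eps) ^+ (d.-1 - i) * y ^+ i.
have -> : (y + eps) ^+ d - x = (S - lcst O d%:R) * eps.
  have e1 : (y + eps) ^+ d - y ^+ d = eps * S by rewrite subrXX addrAC subrr add0r.
  have e2 : lcst O d%:R * eps = x - y ^+ d.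
    by rewrite mulrA -rmorphM divff // rmorph1 mul1r.
  by rewrite mulrBl e2 mulrC -e1; ring.
apply: mpow_mul => //; apply/lvalP; rewrite rmorphB /= lval_cst rmorph_sum.
rewrite (eq_bigr (fun=> 1)) => [|i _].
  by rewrite sumr_const card_ord subrr.
by rewrite rmorphM !rmorphXn rmorphD /= y1 eps0 addr0 !expr1n mulr1.
Qed.

End Roots.

Section Monomials.
Variables (A : comUnitRingType) (N : nat).
Implicit Types (P : 'I_N -> A) (v w : 'I_N -> int).

Definition mon P v := \prod_j P j ^ v j.

Lemma mon_unit P v : (forall j, P j \is a GRing.unit) -> mon P v \is a GRing.unit.
Proof. by move=> uP; apply: unitr_prod => j _; exact: unitrXz. Qed.

Lemma mon_eq P v w : v =1 w -> mon P v = mon P w.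
Proof. by move=> vw; apply: eq_bigr => j _; rewrite vw. Qed.

Section Units.
Variables (P : 'I_N -> A) (uP : forall j, P j \is a GRing.unit).

Lemma monD v w : mon P (fun j => v j + w j) = mon P v * mon P w.
Proof. by rewrite -big_split; apply: eq_bigr => j _; rewrite exprzDr. Qed.

Lemma monZ v c : mon P (fun j => v j * c) = mon P v ^ c.
Proof.
have e1 : 1 ^ c = 1 :> A by rewrite exp1rz.
rewrite /mon; elim: (index_enum _) => [|j s IH]; first by rewrite !big_nil e1.
rewrite !big_cons IH exprMz_comm ?unitrXz -?exprz_exp //; last exact: mulrC.
by apply: unitr_prod => i _; exact: unitrXz.
Qed.

Lemma mon0 : mon P (fun=> 0) = 1.
Proof. by rewrite /mon big1. Qed.

Lemma mon_sum r (V : 'I_r -> 'I_N -> int) (e : 'I_r -> int) :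
  \prod_l mon P (V l) ^ e l = mon P (fun j => \sum_l V l j * e l).
Proof.
rewrite /mon; under eq_bigr do rewrite -monZ.
rewrite exchange_big; apply: eq_bigr => j _.
by elim/big_rec2: _ => // i y x _ ->; rewrite exprzDr.
Qed.

Lemma mon_delta j0 c : mon P (fun j => c *+ (j == j0)) = P j0 ^ c.
Proof.
rewrite /mon (bigD1 j0) //= eqxx mulr1n big1 ?mulr1 // => j /negPf ->.
by rewrite mulr0n.
Qed.

End Units.

Lemma congXz (J : A -> Prop) c x y : is_ideal J ->
  x \is a GRing.unit -> y \is a GRing.unit -> cong J x y -> cong J (x ^ c) (y ^ c).
Proof.
move=> idJ ux uy xy; case: c => k; first exact: congX.
rewrite /exprz /=; move: (congX idJ k.+1 xy) => /cong_sym -/(_ idJ).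
have uX : x ^+ k.+1 \is a GRing.unit by rewrite unitrX.
have uY : y ^+ k.+1 \is a GRing.unit by rewrite unitrX.
case: idJ => _ _ JM /(JM ((x ^+ k.+1)^-1 * (y ^+ k.+1)^-1)).
by rewrite mulrBr -mulrA mulVr // mulr1 mulrAC mulVr // mul1r.
Qed.

Lemma mon_cong (J : A -> Prop) P Q v : is_ideal J ->
  (forall j, P j \is a GRing.unit) -> (forall j, Q j \is a GRing.unit) ->
  (forall j, cong J (P j) (Q j)) -> cong J (mon P v) (mon Q v).
Proof. by move=> idJ uP uQ PQ; apply: cong_prod => // j _; exact: congXz. Qed.

End Monomials.

Lemma mon_rmorph (A B : comUnitRingType) (phi : {rmorphism A -> B}) N
    (P : 'I_N -> A) (v : 'I_N -> int) :
  (forall j, P j \is a GRing.unit) -> phi (mon P v) = mon (phi \o P) v.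
Proof.
by move=> uP; rewrite rmorph_prod; apply: eq_bigr => j _; rewrite rmorphXz.
Qed.

(** * The two parametrizations of the intersection *)

Section GermIsomorphism.
Variables (K : numFieldType) (n m N : nat).
(* In the application [ab l j] is the l-th coordinate of a_j - a_0, and the rows
   of D are the delta_j. *)
Variables (ab : 'I_n -> 'I_N.+1 -> int) (B : 'I_m -> 'I_N.+1 -> int).
Variables (C : 'M[K]_(n, N.+1)) (D : 'M[K]_(N.+1, m)).
Variables (OT : local_alg (const_mx 1 : 'rV[K]_n)) (OY : local_alg (0 : 'rV[K]_m)).

Definition torus_coord j : OT := mon (@lvar _ _ _ OT) (ab^~ j).
Definition gale_form j : OY := 1 + \sum_k lcst OY (D j k) * lvar OY k.
Definition sparse_form i : OT := \sum_j lcst OT (C i j) * torus_coord j.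
Definition gale_binom k : OY := mon gale_form (B k) - 1.

Hypothesis ab0 : forall l, ab l 0 = 0.
Hypothesis D0 : row 0 D = 0.
Hypothesis C1 : C *m (const_mx 1 : 'cV_N.+1) = 0.
Hypothesis CD : C *m D = 0.
(* The matrices E, F and F0 express that D parametrizes the vectors of the
   kernel of C whose entry of index 0 vanishes. *)
Variables (E : 'M[K]_(m, N.+1)) (F : 'M[K]_(N.+1, n)) (F0 : 'cV[K]_N.+1).
Hypothesis ED : E *m D = 1%:M.
Hypothesis DEFC : 1%:M = D *m E + F *m C + F0 *m delta_mx 0 0.
(* M / d is a rational right inverse of [ab]. *)
Variables (d : nat) (M : 'I_n -> 'I_N.+1 -> int).
Hypothesis d_gt0 : (0 < d)%N.
Hypothesis abM : forall l l', \sum_j ab l j * M l' j = d%:Z *+ (l == l').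
Hypothesis abB : forall l k, \sum_j ab l j * B k j = 0.
(* The columns of B and the unit vector of index 0 span the rational kernel of
   [ab]; both the form and the torus coordinate of index 0 are 1. *)
Hypothesis ab_ker : forall v : 'I_N.+1 -> int, (forall l, \sum_j ab l j * v j = 0) ->
  exists (d' : nat) (w : 'I_m -> int) (c : int), (0 < d')%N /\
    forall j, v j * d'%:Z = \sum_k B k j * w k + c *+ (j == 0).

Lemma mon_exp (A : comUnitRingType) r (P : 'I_r -> A) v k :
  mon (fun j => P j ^+ k) v = mon P v ^+ k.
Proof.
by rewrite /mon -prodrXl; apply: eq_bigr => j _; rewrite (exprzAC (P j) k).
Qed.

Lemma lval_mon r (p : 'rV[K]_r) (O : local_alg p) N' (P : 'I_N' -> O) v :
  (forall j, lval O (P j) = 1) -> lval O (mon P v) = 1.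
Proof.
move=> P1; rewrite mon_rmorph => [|j]; last by rewrite lcar_unit P1 oner_eq0.
by rewrite /mon big1 // => j _; rewrite /= P1 exp1rz.
Qed.

Lemma unit_of1 r (p : 'rV[K]_r) (O : local_alg p) (x : O) :
  lval O x = 1 -> x \is a GRing.unit.
Proof. by move=> x1; rewrite lcar_unit x1 oner_eq0. Qed.

Let var1 l : lval OT (lvar OT l) = 1.
Proof. by rewrite lval_var mxE. Qed.

Let uvar l : lvar OT l \is a GRing.unit.
Proof. exact: unit_of1. Qed.

Let z1 j : lval OT (torus_coord j) = 1.
Proof. exact: lval_mon. Qed.

Let uz j : torus_coord j \is a GRing.unit.
Proof. exact: unit_of1. Qed.

Lemma lval_gale_form j : lval OY (gale_form j) = 1.
Proof.
rewrite rmorphD rmorph1 rmorph_sum big1 ?addr0 // => k _.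
by rewrite rmorphM /= lval_var mxE mulr0.
Qed.

Let up j : gale_form j \is a GRing.unit.
Proof. exact/unit_of1/lval_gale_form. Qed.

Let z0 : torus_coord 0 = 1.
Proof. by rewrite -(mon0 (@lvar _ _ _ OT)); apply: mon_eq => l; exact: ab0. Qed.

Let p0 : gale_form 0 = 1.
Proof.
rewrite /gale_form big1 ?addr0 // => k _.
have /matrixP/(_ 0 k) := D0; rewrite !mxE => ->.
by rewrite rmorph0 mul0r.
Qed.

Let C1row i : \sum_j C i j = 0.
Proof.
have /matrixP/(_ i 0) := C1; rewrite !mxE => e; rewrite -[RHS]e.
by apply: eq_bigr => j _; rewrite mxE mulr1.
Qed.

Let sparse_formE i : sparse_form i = \sum_j lcst OT (C i j) * (torus_coord j - 1).
Proof.
under [RHS]eq_bigr do rewrite mulrBr mulr1.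
by rewrite sumrB -rmorph_sum C1row rmorph0 subr0.
Qed.

Let Y k : OT := \sum_j lcst OT (E k j) * (torus_coord j - 1).

(** The equation [DEFC] applied to the vector z - 1.  Its entry 0 vanishes, which
    kills the term with F0. *)
Let zE j : torus_coord j - 1 =
  \sum_k lcst OT (D j k) * Y k + \sum_i lcst OT (F j i) * sparse_form i.
Proof.
have -> : torus_coord j - 1 = \sum_j' lcst OT ((1%:M : 'M_N.+1) j j') * (torus_coord j' - 1).
  rewrite (bigD1 j) //= mxE eqxx rmorph1 mul1r big1 ?addr0 // => j' /negPf nj.
  by rewrite mxE eq_sym nj rmorph0 mul0r.
under eq_bigr => j' _ do rewrite DEFC !mxE big_ord1 mxE eqxx andTb rmorphD mulrDl.
rewrite big_split [X in _ + X = _]big1 ?addr0 => [|j' _]; last first.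
  have [->|_] := eqVneq j' 0; first by rewrite z0 subrr mulr0.
  by rewrite mulr0 rmorph0 mul0r.
under eq_bigr => j' _ do rewrite rmorphD mulrDl !rmorph_sum !mulr_suml.
rewrite big_split; congr (_ + _); rewrite exchange_big; apply: eq_bigr => k _.
  by rewrite mulr_sumr; apply: eq_bigr => j' _; rewrite rmorphM mulrA.
by rewrite sparse_formE mulr_sumr; apply: eq_bigr => j' _; rewrite rmorphM mulrA.
Qed.

Let Y0 k : lval OT (Y k) = (0 : 'rV[K]_m) 0 k.
Proof.
rewrite mxE rmorph_sum big1 // => j _.
by rewrite rmorphM rmorphB rmorph1 /= z1 subrr mulr0.
Qed.

Let gale_form_expand j : (\sum_k lcst OY (D j k) * lvar OY k) = gale_form j - 1.
Proof. by rewrite /gale_form addrC addKr. Qed.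

(** Substituting E (z - 1) for y sends each form to the torus coordinate with
    the same index, modulo the sparse system: this is the decomposition [DEFC]
    applied to z - 1. *)
Let beta_exists : exists beta : {rmorphism OY -> OT},
  [/\ forall c, beta (lcst OY c) = lcst OT c, forall k, beta (lvar OY k) = Y k &
      forall j, cong (generated sparse_form) (beta (gale_form j)) (torus_coord j)].
Proof.
have [beta [betaC betaY]] := hom_exists OY Y0; exists beta; split=> // j.
apply: cong_sym; first exact: generated_ideal.
exists (fun i => lcst OT (F j i)).
rewrite rmorphD rmorph1 opprD addrA zE rmorph_sum.
under [X in _ - X]eq_bigr do rewrite rmorphM betaC betaY.
by rewrite addrC addKr.
Qed.

Let mon_torus_coord v : mon torus_coord v = mon (@lvar _ _ _ OT) (fun l => \sum_j ab l j * v j).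
Proof. exact: (mon_sum uvar (fun j => ab^~ j)). Qed.

Let beta_binom (beta : {rmorphism OY -> OT}) :
  (forall j, cong (generated sparse_form) (beta (gale_form j)) (torus_coord j)) ->
  forall x, generated gale_binom x -> generated sparse_form (beta x).
Proof.
move=> bp x; apply: (generated_map (J := generated sparse_form)) => [|k]; first exact: generated_ideal.
have -> : beta (gale_binom k) = beta (mon gale_form (B k)) - mon torus_coord (B k).
  rewrite rmorphB rmorph1 mon_torus_coord; congr (_ - _).
  by rewrite (@mon_eq _ _ _ _ (fun=> 0)) ?mon0 // => l; exact: abB.
rewrite mon_rmorph //; apply: (mon_cong (J := generated sparse_form)) => //; first exact: generated_ideal.
by move=> j /=; exact: rmorph_unit.
Qed.

(** A multiple of v by some d' > 0 is a combination of the columns of B, up to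
    the coordinate 0, where the form is 1.  So the d'-th power of the monomial
    is 1 modulo the binomials, and uniqueness of roots removes the exponent
    d'. *)
Let mon_ker (J : OY -> Prop) v : is_ideal J -> (forall x, generated gale_binom x -> J x) ->
  (forall l, \sum_j ab l j * v j = 0) -> cong J (mon gale_form v) 1.
Proof.
move=> idJ gJ /ab_ker[d' [w [c [d'0 vE]]]].
apply: (root_unique idJ d'0); [exact/lval_mon/lval_gale_form|exact: rmorph1|].
rewrite expr1n (_ : _ ^+ d' = \prod_k mon gale_form (B k) ^ w k).
  have e1 : \prod_(k < m) (1 : OY) ^ w k = 1.
    by rewrite big1 // => k _; rewrite exp1rz.
  rewrite -[X in cong J _ X]e1; apply: (cong_prod idJ) => k _; apply: congXz => //.
  - by apply: mon_unit => j; exact: up.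
  - exact: unitr1.
  exact: (gJ _ (generated_gen gale_binom k)).
rewrite mon_sum // -[LHS]/(mon gale_form v ^ d'%:Z) -monZ //.
rewrite (mon_eq _ vE) monD //.
by rewrite mon_delta // p0 exp1rz mulr1.
Qed.

(** The substitution of [prod_j q_j^(M_jl)] for x_l, where q_j is an
    approximate d-th root of the form with index j. *)
Let alpha_exists k : exists (q : 'I_N.+1 -> OY) (alpha : {rmorphism OT -> OY}),
  [/\ forall j, lval OY (q j) = 1,
      forall j, cong (mpow (@lpar _ _ _ OY) k) (q j ^+ d) (gale_form j),
      forall c, alpha (lcst OT c) = lcst OY c &
      forall l, alpha (lvar OT l) = mon q (M l)].
Proof.
have /choice[q qP] j := root_exists k d_gt0 (lval_gale_form j).
have X1 l : lval OY (mon q (M l)) = (const_mx 1 : 'rV[K]_n) 0 l.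
  by rewrite mxE lval_mon // => j; case: (qP j).
have [alpha [aC aX]] := hom_exists OT X1.
by exists q, alpha; split=> // j; case: (qP j).
Qed.

(** The d-th powers of both sides are monomials in the forms, and their
    exponents differ by a vector in the kernel of [ab]. *)
Let alpha_coord (J : OY -> Prop) (q : 'I_N.+1 -> OY) (alpha : {rmorphism OT -> OY}) :
  is_ideal J -> (forall x, generated gale_binom x -> J x) ->
  (forall j, lval OY (q j) = 1) -> (forall j, cong J (q j ^+ d) (gale_form j)) ->
  (forall l, alpha (lvar OT l) = mon q (M l)) ->
  forall j, cong J (alpha (torus_coord j)) (gale_form j).
Proof.
move=> idJ gJ q1 qp aX j.
have uq i : q i \is a GRing.unit by exact: unit_of1.
pose v i := \sum_l M l i * ab l j.
have aE : alpha (torus_coord j) = mon q v.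
  by rewrite mon_rmorph // -mon_sum //; apply: eq_bigr => l _; rewrite /= aX.
apply: (root_unique idJ d_gt0); [by rewrite aE lval_mon|exact: lval_gale_form|].
rewrite aE -mon_exp; apply: (cong_trans idJ (y := mon gale_form v)).
  by apply: mon_cong => // i; rewrite unitrX.
pose u i := v i - d%:Z *+ (i == j).
rewrite (@mon_eq _ _ _ v (fun i => u i + d%:Z *+ (i == j))) => [|i]; last by rewrite subrK.
rewrite monD // mon_delta // -[X in cong J _ X]mul1r; apply: congM => //; last exact: congxx.
apply: mon_ker => // l; rewrite /u /v.
under eq_bigr do rewrite mulrBr mulr_sumr.
have -> : \sum_i (\sum_l0 ab l i * (M l0 i * ab l0 j) - ab l i * (d%:Z *+ (i == j))) =
    \sum_l0 \sum_i ab l i * (M l0 i * ab l0 j) - ab l j * d%:Z.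
  rewrite sumrB exchange_big; congr (_ - _); rewrite (bigD1 j) //= eqxx big1 ?addr0 //.
  by move=> i /negPf ->; rewrite mulr0n mulr0.
rewrite (eq_bigr (fun l' => d%:Z *+ (l == l') * ab l' j)) => [|l' _]; last first.
  by rewrite -abM mulr_suml; apply: eq_bigr => i _; rewrite mulrA.
rewrite (bigD1 l) //= eqxx mulr1n big1 => [|l' /negPf nl]; last first.
  by rewrite eq_sym nl mulr0n mul0r.
by rewrite addr0 mulrC subrr.
Qed.

(** That [beta] after [alpha] fixes x_l is seen on d-th powers, where it becomes
    the identity of monomials expressed by [abM].  That [alpha] after [beta]
    fixes y_k is the equation [ED]. *)
Lemma gale_approx_iso : approx_iso (generated sparse_form) (generated gale_binom).
Proof.
move=> k J1 J2.
have idf := generated_ideal sparse_form; have idg := generated_ideal gale_binom.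
have idm1 := mpow_ideal (@lpar _ _ _ OT) k.
have idm2 := mpow_ideal (@lpar _ _ _ OY) k.
have id1 : is_ideal J1 by exact: ideal_sum_ideal.
have id2 : is_ideal J2 by exact: ideal_sum_ideal.
have fJ x : generated sparse_form x -> J1 x by exact: ideal_suml.
have gJ x : generated gale_binom x -> J2 x by exact: ideal_suml.
have [beta [bC bY bp]] := beta_exists.
have [q [alpha [q1 qp aC aX]]] := alpha_exists k.
have qp2 j : cong J2 (q j ^+ d) (gale_form j) by apply: ideal_sumr => //; exact: qp.
have az := alpha_coord id2 gJ q1 qp2 aX.
have uq i : q i \is a GRing.unit by exact: unit_of1.
exists alpha, beta; split=> //.
- move=> x; apply: (generated_map (J := J2)) => // i.
  have : cong J2 (alpha (sparse_form i)) (\sum_j lcst OY (C i j) * gale_form j).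
    rewrite rmorph_sum; apply: cong_sum => // j; rewrite rmorphM aC.
    exact: congMl.
  move=> /cong_ideal; apply=> //.
  have -> : \sum_j lcst OY (C i j) * gale_form j = 0; last by case: id2.
  under eq_bigr do rewrite mulrDr mulr1 mulr_sumr.
  rewrite big_split /= -rmorph_sum C1row rmorph0 add0r exchange_big big1 // => l _.
  under eq_bigr do rewrite mulrA -rmorphM.
  rewrite -mulr_suml -rmorph_sum.
  by have /matrixP/(_ i l) := CD; rewrite !mxE => ->; rewrite rmorph0 mul0r.
- by move=> x /(beta_binom bp) /fJ.
- apply: (rmorph_eq_cong (phi := beta \o alpha) (psi := idfun) id1) => [c|l] /=.
    by rewrite aC bC.
  rewrite aX mon_rmorph //.
  have lb x : lval OT (beta x) = lval OY x by exact: lval_hom.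
  apply: (root_unique id1 d_gt0) => //.
    by rewrite lval_mon // => j /=; rewrite lb.
  rewrite -mon_exp; apply: (cong_trans id1 (y := mon torus_coord (M l))).
    apply: mon_cong => // j; first by rewrite unitrX // /= rmorph_unit.
    rewrite /= -rmorphXn; apply: (cong_trans id1 (y := beta (gale_form j))).
      rewrite /cong -rmorphB; apply: ideal_sumr => //; apply: hom_mpow => //.
      exact: qp.
    exact/fJ/bp.
  rewrite mon_torus_coord (@mon_eq _ _ _ _ (fun l' => d%:Z *+ (l' == l))) => [|l'].
    by rewrite mon_delta //; exact: congxx.
  by rewrite abM.
- apply: (rmorph_eq_cong (phi := alpha \o beta) (psi := idfun) id2) => [c|l] /=.
    by rewrite bC aC.
  rewrite bY rmorph_sum; apply: (cong_trans id2 (y := \sum_j lcst OY (E l j) * (gale_form j - 1))).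
    apply: cong_sum => // j; rewrite rmorphM aC; apply: congMl => //.
    by rewrite rmorphB rmorph1; apply: congD => //; exact: congxx.
  rewrite (_ : \sum_j _ = lvar OY l); first exact: congxx.
  under eq_bigr do rewrite -gale_form_expand mulr_sumr.
  rewrite exchange_big (bigD1 l) //= [X in _ + X]big1 => [|l' nl]; last first.
    under eq_bigr do rewrite mulrA -rmorphM.
    rewrite -mulr_suml -rmorph_sum; have /matrixP/(_ l l') := ED.
    by rewrite !mxE => ->; rewrite eq_sym (negPf nl) rmorph0 mul0r.
  under eq_bigr do rewrite mulrA -rmorphM.
  rewrite addr0 -mulr_suml -rmorph_sum; have /matrixP/(_ l l) := ED.
  by rewrite !mxE => ->; rewrite eqxx rmorph1 mul1r.
Qed.

Lemma gale_codim mu :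
  has_codim (lcst OT) (generated sparse_form) mu <-> has_codim (lcst OY) (generated gale_binom) mu.
Proof.
have idf := generated_ideal sparse_form; have idg := generated_ideal gale_binom.
split; apply: codim_approx_iso => //; first exact: gale_approx_iso.
exact/approx_iso_sym/gale_approx_iso.
Qed.

End GermIsomorphism.

(** * Dimension of the local ring and isolated points *)

Section Dim.
Variables (K : fieldType) (n : nat) (p : 'rV[K]_n) (O : local_alg p).

Lemma local_ideal_germ r (f : 'I_r -> ratfun K n) (F : 'I_r -> O) :
  (forall i, f i = lgerm O (F i)) ->
  forall q, local_ideal f p (lgerm O q) <-> generated F q.
Proof.
move=> fF q; split=> [[h [hr e]]|[h ->]].
  have /choice[g gP] i : exists x, lgerm O x = h i by exact/lgerm_im.
  exists g; apply: (@lgerm_inj _ _ _ O); rewrite e rmorph_sum.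
  by apply: eq_bigr => i _; rewrite rmorphM /= gP fF.
exists (fun i => lgerm O (h i)); split=> [i|]; first by apply/lgerm_im; exists (h i).
by rewrite rmorph_sum; apply: eq_bigr => i _; rewrite rmorphM /= fF.
Qed.

Lemma lgerm_cst c : lgerm O (lcst O c) = constf n c.
Proof. exact: lgerm_pol. Qed.

(** The dimension defined inside the field of rational functions is the one of
    the quotient of the local ring. *)
Lemma local_ring_dimE r (f : 'I_r -> ratfun K n) (F : 'I_r -> O) mu :
  (forall i, f i = lgerm O (F i)) ->
  local_ring_dim f p mu <-> has_codim (lcst O) (generated F) mu.
Proof.
move=> /local_ideal_germ idE.
have comb (e : 'I_mu -> O) q (c : 'rV[K]_mu) :
    lgerm O (q - \sum_l lcst O (c 0 l) * e l) =
    lgerm O q - \sum_l constf n (c 0 l) * lgerm O (e l).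
  rewrite rmorphB rmorph_sum; congr (_ - _); apply: eq_bigr => l _.
  by rewrite rmorphM /= lgerm_cst.
split=> [[e [er eP]]|[e eP]].
  have /choice[g gP] l : exists x, lgerm O x = e l by exact/lgerm_im.
  have {gP} ge : e = lgerm O \o g by apply/funext => l; rewrite /= gP.
  exists g => q; have [|c [cP cU]] := eP (lgerm O q).
    by apply/lgerm_im; exists q.
  rewrite ge in cP cU.
  exists c; split=> [|c' /idE]; first by apply: (idE _).1; rewrite comb.
  by rewrite comb; exact: cU.
exists (fun l => lgerm O (e l)); split=> [l|_ /(lgerm_im O)[q <-]].
  by apply/lgerm_im; exists (e l).
have [c [cP cU]] := eP q; exists c; split=> [|c'].
  by rewrite -comb; apply: (idE _).2.
by rewrite -comb => /idE; exact: cU.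
Qed.

Lemma generated_unit r (F G : 'I_r -> O) (u : 'I_r -> O) :
  (forall i, u i \is a GRing.unit) -> (forall i, F i = u i * G i) -> generated F = generated G.
Proof.
move=> uu FG; apply/funext => x; apply/propext; split=> [[h ->]|[h ->]].
  by exists (fun i => h i * u i); apply: eq_bigr => i _; rewrite FG mulrA.
exists (fun i => h i / u i); apply: eq_bigr => i _.
by rewrite FG mulrA divrK.
Qed.

End Dim.

Section Isolated.
Local Open Scope classical_set_scope.
Variable K : numFieldType.

Lemma meval_continuous n (u : {mpoly K[n]}) :
  continuous (fun x : 'rV[K]_n => u.@[x 0]).
Proof.
have -> : (fun x : 'rV[K]_n => u.@[x 0]) =
    (fun x => \sum_(m <- msupp u) u@_m * \prod_i x 0 i ^+ m i).
  by apply/funext => x; rewrite mevalE.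
have cM (f g : 'rV[K]_n -> K) :
    continuous f -> continuous g -> continuous (fun x => f x * g x).
  by move=> cf cg x; exact: (cvgM (cf x) (cg x)).
apply: continuous_big => [|m _]; first exact: add_continuous.
apply: (cM); first exact: cst_continuous.
apply: continuous_big => [|i _]; first exact: mul_continuous.
elim: (m i) => [|k IHk]; first exact: cst_continuous.
have -> : (fun x : 'rV[K]_n => x 0 i ^+ k.+1) = fun x => x 0 i * x 0 i ^+ k.
  by apply/funext => x; rewrite exprS.
by apply: (cM) IHk; exact: coord_continuous.
Qed.

Lemma meval_neq0_nbhs n (p : 'rV[K]_n) (v : {mpoly K[n]}) :
  v.@[p 0] != 0 -> nbhs p [set x : 'rV[K]_n | v.@[x 0] != 0].
Proof.
move=> v0; exact: (cvgr_neq0 _ (@meval_continuous n v p) v0).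
Qed.

(** The mu-th power of each x_l - p_l is a combination of the f_i with
    coefficients regular at p.  On the open set where their denominators do not
    vanish the identity can be evaluated at any common zero of the f_i.  Being a
    zero is expressed by germs at x, so as to cover Laurent polynomials. *)
Lemma codim_isolated n (p : 'rV[K]_n) r (f : 'I_r -> ratfun K n) (O : local_alg p)
    (F : 'I_r -> O) mu : (forall i, f i = lgerm O (F i)) ->
  has_codim (lcst O) (generated F) mu ->
  exists2 V, nbhs p V & forall (x : 'rV[K]_n) (Ox : local_alg x) (G : 'I_r -> Ox),
    V x -> (forall i, f i = lgerm Ox (G i)) -> (forall i, lval Ox (G i) = 0) -> x = p.
Proof.
move=> fF cod.
have /choice[h hP] l : exists h : 'I_r -> O, lpar O l ^+ mu = \sum_i h i * F i.
  apply: (codim_mpow (generated_ideal F) cod).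
  elim: mu {cod} => [|k IH] //; rewrite exprS.
  by apply: mpow_mul => //; exact: generated_gen.
have /choice[w wP] (li : 'I_n * 'I_r) : exists uv : {mpoly K[n]} * {mpoly K[n]},
    uv.2.@[p 0] != 0 /\ lgerm O (h li.1 li.2) = polyf uv.1 / polyf uv.2.
  have [u [v [v0 e]]] : regular_at p (lgerm O (h li.1 li.2)).
    by apply/lgerm_im; eexists.
  by exists (u, v).
pose v := \prod_li (w li).2.
exists [set x : 'rV[K]_n | v.@[x 0] != 0].
  apply: meval_neq0_nbhs; rewrite /v rmorph_prod.
  by apply/prodf_neq0 => li _; case: (wP li).
move=> x Ox G /= vx fG G0; apply/rowP => l.
have /choice[h' h'P] i : exists y, lgerm Ox y = lgerm O (h l i).
  apply/lgerm_im; exists (w (l, i)).1, (w (l, i)).2; split; last by case: (wP (l, i)).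
  by move: vx; rewrite /v rmorph_prod => /prodf_neq0; apply.
have : (lvar Ox l - lcst Ox (p 0 l)) ^+ mu = \sum_i h' i * G i.
  apply: (@lgerm_inj _ _ _ Ox); rewrite rmorphXn rmorphB rmorph_sum /= !lgerm_pol.
  rewrite (eq_bigr (fun i => lgerm O (h l i * F i))) => [|i _]; last first.
    by rewrite !rmorphM /= h'P -fG fF.
  rewrite -rmorph_sum -hP rmorphXn rmorphB /= !lgerm_pol //.
move=> /(congr1 (lval Ox)); rewrite rmorphXn rmorphB rmorph_sum /= lval_var lval_cst.
rewrite big1 => [/eqP|i _]; last by rewrite rmorphM /= G0 mulr0.
by rewrite expf_eq0 subr_eq0 => /andP[_ /eqP].
Qed.

End Isolated.

(** * Linear algebra of the exponents and of the coefficients *)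

Lemma common_denominator (T : finType) (f : T -> rat) :
  exists (d : nat) (g : T -> int), (0 < d)%N /\ forall t, f t * d%:R = (g t)%:~R.
Proof.
pose d := \prod_t denq (f t); have d0 : 0 < d by apply: prodr_gt0 => t _; exact: denq_gt0.
exists `|d|%N, (fun t => numq (f t) * \prod_(s | s != t) denq (f s)); split=> [|t].
  by rewrite absz_gt0 gt_eqF.
have -> : (`|d|%N)%:R = d%:~R :> rat by rewrite natr_absz gtr0_norm.
by rewrite /d (bigD1 t) //= !intrM numqE mulrA.
Qed.

Section Exponents.
Variables (R : realType) (n m : nat) (a : 'I_(n + m).+1 -> 'rV[int]_n).
Hypothesis a_hyp : ~ in_affine_hyperplane R a.
Notation N := (n + m)%N.
Let A : 'M[rat]_(1 + n, N.+1) := map_mx intr (exponent_mx a).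

Let A0 j : A (lshift n 0) j = 1.
Proof. by rewrite mxE col_mxEu mxE. Qed.

Let Al l j : A (rshift 1 l) j = (a j 0 l)%:~R.
Proof. by rewrite mxE col_mxEd mxE. Qed.

(** A rational relation between the rows is an affine form vanishing at all
    the exponents. *)
Lemma exponent_row_free : row_free A.
Proof.
rewrite -kermx_eq0; apply/rowV0P => u /sub_kermxP uA.
pose c := u 0 (lshift n 0); pose w := rsubmx u.
have uE j : c + \sum_l w 0 l * (a j 0 l)%:~R = 0.
  have /matrixP/(_ 0 j) := uA; rewrite mxE [RHS]mxE big_split_ord big_ord1 /=.
  rewrite A0 mulr1 => e; rewrite -[RHS]e; congr (_ + _); apply: eq_bigr => l _.
  by rewrite Al mxE.
have w0 : w = 0.
  apply/eqP/negPn/negP => w0; apply: a_hyp.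
  exists (map_mx ratr w), (- ratr c); split; first by rewrite map_mx_eq0.
  move=> j; apply/eqP; rewrite -addr_eq0; apply/eqP.
  transitivity (ratr (c + \sum_l w 0 l * (a j 0 l)%:~R) : R).
    rewrite rmorphD rmorph_sum addrC; congr (_ + _).
    by apply: eq_bigr => l _; rewrite mxE rmorphM /= ratr_int.
  by rewrite uE rmorph0.
have c0 : c = 0 by have := uE 0; rewrite w0 big1 ?addr0 // => l _; rewrite mxE mul0r.
rewrite -[u]hsubmxK -/w w0 (_ : lsubmx u = 0) ?row_mx0 //.
by apply/rowP => i; rewrite !mxE (ord1 i) -/c c0.
Qed.

Definition shifted_exponent l j : int := a j 0 l - a 0 0 l.
Notation ab := shifted_exponent.

(** The matrix of the a_j - a_0 inherits a right inverse from the one of A: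
    drop its first column, whose index is that of the row of ones.  The other
    columns have sum 0, so that subtracting a_0 changes nothing. *)
Lemma shifted_right_inverse : exists (d : nat) (M : 'I_n -> 'I_N.+1 -> int),
  (0 < d)%N /\ forall l l', \sum_j ab l j * M l' j = d%:Z *+ (l == l').
Proof.
have [d [g [d0 gP]]] := common_denominator
  (fun lj : 'I_n * 'I_N.+1 => pinvmx A lj.2 (rshift 1 lj.1)).
exists d, (fun l j => g (l, j)); split=> // l l'.
have AM i i' : \sum_j A i j * pinvmx A j i' = (i == i')%:R.
  by have /matrixP/(_ i i') := mulmxVp exponent_row_free; rewrite !mxE.
apply: (@intr_inj rat); rewrite rmorph_sum /=.
transitivity (\sum_j (A (rshift 1 l) j * pinvmx A j (rshift 1 l') * d%:R
    - (a 0 0 l)%:~R * (A (lshift n 0) j * pinvmx A j (rshift 1 l')) * d%:R)).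
  apply: eq_bigr => j _; rewrite A0 Al intrM -gP /= rmorphB /=; ring.
rewrite sumrB -!mulr_suml -mulr_sumr !AM eq_lrshift mulr0 mul0r subr0.
rewrite (inj_eq (@rshift_inj _ _)).
by case: (l == l'); rewrite ?mul1r ?mul0r ?mulr1n ?mulr0n.
Qed.

Variable B : 'M[int]_(N.+1, m).
Hypothesis galeB : int_gale_dual (exponent_mx a) B.

Lemma gale_dual_shifted l k : \sum_j ab l j * B j k = 0.
Proof.
have [_ AB] := galeB.
have /matrixP/(_ (lshift n 0) k) := AB; rewrite mxE [RHS]mxE => B0.
have /matrixP/(_ (rshift 1 l) k) := AB; rewrite mxE [RHS]mxE => Bl.
under eq_bigr do rewrite mulrBl.
rewrite sumrB -mulr_sumr.
have -> : \sum_j B j k = 0.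
  by rewrite -[RHS]B0; apply: eq_bigr => j _; rewrite col_mxEu mxE mul1r.
rewrite mulr0 subr0 -[RHS]Bl; apply: eq_bigr => j _.
by rewrite col_mxEd mxE.
Qed.

(** The kernel of A has dimension m, and so has the column space of B. *)
Lemma gale_dual_spans (V : 'cV[rat]_N.+1) : A *m V = 0 ->
  exists W, V = map_mx intr B *m W.
Proof.
move=> AV; have [rB AB] := galeB; pose BQ : 'M[rat]_(N.+1, m) := map_mx intr B.
have sB : (BQ^T <= kermx A^T)%MS.
  by apply/sub_kermxP; rewrite -trmx_mul -map_mxM AB map_mx0 trmx0.
have : (kermx A^T <= BQ^T)%MS.
  rewrite -(mxrank_leqif_sup sB) mxrank_ker !mxrank_tr rB.
  by rewrite (eqP exponent_row_free) -addSn (addKn (1 + n)%N m).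
have sV : (V^T <= kermx A^T)%MS by apply/sub_kermxP; rewrite -trmx_mul AV trmx0.
move=> /(submx_trans sV) /submxP[W e]; exists W^T.
by rewrite -[LHS]trmxK e trmx_mul trmxK.
Qed.

(** A vector killed by the a_j - a_0 need not have sum 0, but since the entry of
    index 0 of these differences vanishes, changing the entry of index 0 of the
    vector brings it into the kernel of A. *)
Lemma shifted_kernel (v : 'I_N.+1 -> int) : (forall l, \sum_j ab l j * v j = 0) ->
  exists (d : nat) (w : 'I_m -> int) (c : int), (0 < d)%N /\
    forall j, v j * d%:Z = \sum_k B j k * w k + c *+ (j == 0).
Proof.
move=> abv; pose s := \sum_j v j.
(* V has the same products with the differences as v, and sum 0. *)
pose V : 'cV[int]_N.+1 := \col_j (v j - s *+ (j == 0)).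
have sumV (x : 'I_N.+1 -> int) : \sum_j x j * V j 0 = \sum_j x j * v j - x 0 * s.
  under eq_bigr do rewrite mxE mulrBr.
  rewrite sumrB; congr (_ - _); rewrite (bigD1 0) //= mulr1n big1 ?addr0 //.
  by move=> j /negPf ->; rewrite mulr0n mulr0.
have AV : exponent_mx a *m V = 0.
  apply/matrixP => i j; rewrite (ord1 j) mxE [RHS]mxE sumV.
  case: (split_ordP i) => l ->.
    under eq_bigr do rewrite col_mxEu mxE mul1r.
    by rewrite col_mxEu mxE mul1r subrr.
  rewrite col_mxEd mxE -[RHS](abv l) mulr_sumr -sumrB.
  by apply: eq_bigr => j' _; rewrite col_mxEd mxE -mulrBl.
have [|W VE] := @gale_dual_spans (map_mx intr V).
  by rewrite -map_mxM AV map_mx0.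
have [d [w [d0 wP]]] := common_denominator (fun k => W k 0).
exists d, w, (s * d%:Z); split=> // j.
suff e : V j 0 * d%:Z = \sum_k B j k * w k.
  rewrite -e mxE; case: (j == 0); rewrite ?(mulr1n, mulr0n) ?subr0 ?addr0 //.
  by rewrite mulrBl subrK.
apply: (@intr_inj rat); rewrite intrM rmorph_sum /=.
have /matrixP/(_ j 0) := VE; rewrite mxE [RHS]mxE => ->.
rewrite mulr_suml; apply: eq_bigr => k _; rewrite mxE intrM -wP.
by rewrite mulrA.
Qed.

End Exponents.

Section KernelDual.
Variables (K : fieldType) (n N m : nat) (C : 'M[K]_(n, N.+1)) (D : 'M[K]_(N.+1, 1 + m)).
Hypotheses (CD : gale_dual C D) (redD : reduced D).

Lemma reduced_mul p (w : 'M_(1 + m, p)) : D *m w = const_mx 1 *m usubmx w + rsubmx D *m dsubmx w.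
Proof. by rewrite -{1}[D]hsubmxK redD.1 -{1}[w]vsubmxK mul_row_col. Qed.

Lemma reduced_kernel : C *m rsubmx D = 0.
Proof.
have [CD0 _] := CD; move: CD0; rewrite -{1}[D]hsubmxK mul_mx_row.
by move=> /(congr1 rsubmx); rewrite row_mxKr => ->; apply/matrixP => i j; rewrite !mxE.
Qed.

(** A relation between the delta_i would, with a zero in front, be a second
    expression of the zero vector in the basis given by D. *)
Lemma reduced_free : row_full (rsubmx D).
Proof.
rewrite -cokermx_eq0; apply/eqP/matrixP => i j; rewrite [RHS]mxE.
have e : rsubmx D *m col j (cokermx (rsubmx D)) = 0.
  by rewrite colE mulmxA mulmx_coker mul0mx.
have [w0 [_ w0U]] := CD.2 0 (mulmx0 _ _).
have z1 : w0 = 0 by apply: w0U; rewrite mulmx0.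
have : w0 = col_mx 0 (col j (cokermx (rsubmx D))).
  by apply: w0U; rewrite reduced_mul col_mxKu col_mxKd e mulmx0 addr0.
rewrite z1 => /(congr1 dsubmx); rewrite col_mxKd => /matrixP/(_ i 0).
by rewrite !mxE => <-.
Qed.

(** The column space of the matrix of the delta_i is the kernel of C together
    with the equation [z_0 = 0], since row 0 of D is (1, 0).  A left inverse E
    makes 1 - D E vanish on that kernel, so its rows are combinations of the
    rows of C and of the first unit row. *)
Lemma reduced_splitting : exists E (F : 'M_(N.+1, n)) (F0 : 'cV_N.+1),
  E *m rsubmx D = 1%:M /\
  1%:M = rsubmx D *m E + F *m C + F0 *m delta_mx 0 0.
Proof.
pose E := pinvmx (rsubmx D); exists E.
have ED : E *m rsubmx D = 1%:M by rewrite mulVpmx // reduced_free.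
pose C' := col_mx C (delta_mx 0 0 : 'rV_N.+1).
have : (1%:M - rsubmx D *m E <= C')%MS.
  rewrite submxE; apply/eqP/matrixP => i j; rewrite [RHS]mxE.
  set v := col j (cokermx C').
  have : C' *m v = 0 by rewrite /v colE mulmxA mulmx_coker mul0mx.
  rewrite mul_col_mx => /eqP; rewrite col_mx_eq0 => /andP[/eqP Cv /eqP v0].
  have [w [vD _]] := CD.2 v Cv.
  have w0 : usubmx w = 0.
    have : row 0 v = 0 by rewrite rowE.
    rewrite vD reduced_mul linearD /= !row_mul redD.2 mul0mx addr0 => /matrixP e.
    apply/matrixP => k l; have := e 0 l; rewrite !mxE big_ord1 !mxE mul1r.
    by rewrite (ord1 k).
  have e : (1%:M - rsubmx D *m E) *m v = 0.
    rewrite vD reduced_mul w0 mulmx0 add0r mulmxBl mul1mx.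
    by rewrite -mulmxA (mulmxA E) ED mul1mx subrr.
  by have /matrixP/(_ i 0) := e; rewrite mxE [RHS]mxE => <-; rewrite mxE; apply: eq_bigr => k _; rewrite !mxE.
move=> /submxP[X]; rewrite -[X]hsubmxK mul_row_col => e.
exists (lsubmx X), (rsubmx X); split=> //.
by rewrite -addrA -e addrC subrK.
Qed.

End KernelDual.

(** * The equations as germs, and the theorem *)

Section SparseGerm.
Variables (K : fieldType) (n N : nat) (C : 'M[K]_(n, N)) (a : 'I_N -> 'rV[int]_n).
Variables (x : 'rV[K]_n) (O : local_alg x).
Hypothesis x_torus : forall l, x 0 l != 0.

(** Laurent polynomials as germs at an arbitrary point of the torus: the
    monomials are invertible there. *)
Definition sparse_germ i : O :=
  \sum_j lcst O (C i j) * mon (@lvar _ _ _ O) (fun l => a j 0 l).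

Lemma lvar_unit l : lvar O l \is a GRing.unit.
Proof. by rewrite lcar_unit lval_var. Qed.

Lemma lgerm_sparse i : sparse_ratfun C a i = lgerm O (sparse_germ i).
Proof.
rewrite rmorph_sum; apply: eq_bigr => j _; rewrite rmorphM /= lgerm_cst mxE.
congr (_ * _); rewrite mon_rmorph; last exact: lvar_unit.
by apply: eq_bigr => l _; rewrite mxE /= lgerm_pol.
Qed.

Lemma lval_sparse i : lval O (sparse_germ i) = sparse_eval C a x i.
Proof.
rewrite rmorph_sum; apply: eq_bigr => j _; rewrite rmorphM /= lval_cst.
congr (_ * _); rewrite mon_rmorph; last exact: lvar_unit.
by apply: eq_bigr => l _; rewrite /= lval_var.
Qed.

End SparseGerm.

Section Solutions.
Variable K : numFieldType.

(** Isolatedness is a consequence of the finite dimension, so only the latter has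
    to be transferred. *)
Lemma sparse_isolated_multE n N (C : 'M[K]_(n, N)) (a : 'I_N -> 'rV[int]_n) mu :
  C *m (const_mx 1 : 'cV_N) = 0 ->
  sparse_isolated_mult C a (const_mx 1) mu <->
  local_ring_dim (sparse_ratfun C a) (const_mx 1) mu.
Proof.
move=> C1; split=> [[]//|dim]; split=> //.
have [O] := local_alg_exists (const_mx 1 : 'rV[K]_n).
have O1 l : (const_mx 1 : 'rV[K]_n) 0 l != 0 by rewrite mxE oner_eq0.
have fF := lgerm_sparse C a O O1.
have [V nV VP] := codim_isolated fF ((local_ring_dimE mu fF).1 dim).
have sol1 : sparse_solutions C a (const_mx 1).
  split=> // i; have /matrixP/(_ i 0) := C1; rewrite mxE [RHS]mxE => e.
  rewrite -[RHS]e; apply: eq_bigr => j _; rewrite mxE; congr (_ * _).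
  by rewrite big1 // => l _; rewrite mxE exp1rz.
split; first exact/mem_set.
exists V => //; apply/seteqP; split=> [x [Vx [x0 xs]]|_ ->] /=; last first.
  by split=> //; exact: nbhs_singleton.
have [Ox] := local_alg_exists x.
apply: (VP x Ox (sparse_germ C a Ox)) => // i; first exact: lgerm_sparse.
by rewrite lval_sparse.
Qed.

Lemma gale_isolated_multE N m (B : 'M[int]_(N, m)) (D : 'M[K]_(N, 1 + m)) mu :
  gale_solutions B D 0 ->
  gale_isolated_mult B D 0 mu <->
  local_ring_dim (fun k => polyf (gale_poly B D k)) 0 mu.
Proof.
move=> sol0; split=> [[]//|dim]; split=> //.
have [O] := local_alg_exists (0 : 'rV[K]_m).
have fF i : polyf (gale_poly B D i) = lgerm O (lpol O (gale_poly B D i)).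
  by rewrite lgerm_pol.
have [V nV VP] := codim_isolated fF ((local_ring_dimE mu fF).1 dim).
split; first exact/mem_set.
exists V => //; apply/seteqP; split=> [x [Vx xs]|_ ->] /=; last first.
  by split=> //; exact: nbhs_singleton.
have [Ox] := local_alg_exists x.
apply: (VP x Ox (fun i => lpol Ox (gale_poly B D i))) => // i.
  by rewrite lgerm_pol.
by rewrite lval_pol xs.
Qed.

End Solutions.

Section GaleGerm.
Variables (K : numFieldType) (m N : nat).
Variables (B : 'M[int]_(N.+1, m)) (D : 'M[K]_(N.+1, 1 + m)).
Variable OY : local_alg (0 : 'rV[K]_m).

Lemma lpol_gale_linear j : lpol OY (gale_linear D j) = gale_form (rsubmx D) OY j.
Proof.
rewrite rmorphD rmorph1 rmorph_sum; congr (_ + _); apply: eq_bigr => k _.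
by rewrite -mul_mpolyC rmorphM.
Qed.

Lemma gale_form_unit j : gale_form (rsubmx D) OY j \is a GRing.unit.
Proof. by rewrite lcar_unit lval_gale_form oner_eq0. Qed.

Let minus k := \prod_(j | B j k < 0) gale_form (rsubmx D) OY j ^+ absz (B j k).

Let minus_unit k : minus k \is a GRing.unit.
Proof. by apply: unitr_prod => j _; rewrite unitrX // gale_form_unit. Qed.

(** Dividing the difference of the two products by the second one, which is a
    unit, gives the binomial p^(B_k) - 1. *)
Lemma lpol_gale_poly k :
  lpol OY (gale_poly B D k) =
  minus k * gale_binom (fun k j => B j k) (rsubmx D) OY k.
Proof.
rewrite rmorphB !rmorph_prod mulrBr mulr1; congr (_ - _); last first.
  by apply: eq_bigr => j _; rewrite rmorphXn /= lpol_gale_linear.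
rewrite /minus big_mkcond [X in X * _]big_mkcond -big_split /=.
apply: eq_bigr => j _; rewrite rmorphXn /= lpol_gale_linear.
have uP := gale_form_unit j; case: (B j k) => [[|b]|b] /=.
- by rewrite mulr1.
- by rewrite mul1r.
- by rewrite /exprz mulrV // unitrX.
Qed.

Lemma gale_solution0 : gale_solutions B D 0.
Proof.
move=> k; rewrite -(lval_pol OY) lpol_gale_poly rmorphM rmorphB rmorph1 /=.
by rewrite lval_mon ?subrr ?mulr0 // => j; exact: lval_gale_form.
Qed.

Lemma generated_gale_poly :
  generated (fun k => lpol OY (gale_poly B D k)) =
  generated (gale_binom (fun k j => B j k) (rsubmx D) OY).
Proof. by apply: generated_unit minus_unit _ => k; exact: lpol_gale_poly. Qed.

End GaleGerm.

(** Both systems are replaced by systems with the same ideals: the sparse one is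
    divided by the unit x^(a_0), and the Gale one is written with binomials. *)
Lemma sparse_gale_mult (R : realType) (n m : nat)
    (a : 'I_(n + m).+1 -> 'rV[int]_n) (K : numFieldType)
    (C : 'M[K]_(n, (n + m).+1))
    (B : 'M[int]_((n + m).+1, m)) (D : 'M[K]_((n + m).+1, 1 + m)) (mu : nat) :
  ~ in_affine_hyperplane R a ->
  C *m (const_mx 1 : 'cV_(n + m).+1) = 0 ->
  int_gale_dual (exponent_mx a) B -> gale_dual C D -> reduced D ->
  sparse_isolated_mult C a (const_mx 1) mu <-> gale_isolated_mult B D 0 mu.
Proof.
move=> a_hyp C1 galeB CD redD.
have [OT] := local_alg_exists (const_mx 1 : 'rV[K]_n).
have [OY] := local_alg_exists (0 : 'rV[K]_m).
have p1 l : (const_mx 1 : 'rV[K]_n) 0 l != 0 by rewrite mxE oner_eq0.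
rewrite sparse_isolated_multE // gale_isolated_multE; last exact: (gale_solution0 B D OY).
rewrite (local_ring_dimE _ (lgerm_sparse C a OT p1)).
rewrite (local_ring_dimE (O := OY) (F := fun k => lpol OY (gale_poly B D k))) => [|k]; last first.
  by rewrite lgerm_pol.
rewrite generated_gale_poly.
have [E [F [F0 [ED DEFC]]]] := reduced_splitting CD redD.
have [d [M [d0 abM]]] := shifted_right_inverse a_hyp.
have -> : generated (sparse_germ C a OT) = generated (sparse_form (shifted_exponent a) C OT).
  apply: (@generated_unit _ _ _ _ _ _ _ (fun=> mon (@lvar _ _ _ OT) (fun l => a 0 0 l))) => i.
    by apply: mon_unit => l; exact: lvar_unit.
  rewrite mulr_sumr; apply: eq_bigr => j _; rewrite mulrCA; congr (_ * _).
  rewrite -monD; last by move=> l; exact: lvar_unit.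
  by apply: mon_eq => l; rewrite addrC subrK.
apply: (gale_codim _ _ _ _ _ _ ED DEFC d0 abM) => //.
- by move=> l; rewrite /shifted_exponent subrr.
- exact: redD.2.
- exact: reduced_kernel CD.
- by move=> l k; exact: gale_dual_shifted.
- exact: (shifted_kernel a_hyp galeB).
Qed.

Theorem theorem4p2 (R : realType) (n m : nat) (hn : (1 <= n)%N) (hm : (1 <= m)%N)
    (a : 'I_(n + m).+1 -> 'rV[int]_n) (a_inj : injective a)
    (a_hyp : ~ in_affine_hyperplane R a)
    (C : 'M[R[i]]_(n, (n + m).+1)) (C_rank : \rank C = n)
    (C_ones : C *m (const_mx 1 : 'cV[R[i]]_(n + m).+1) = 0) :
  (forall (B : 'M[int]_((n + m).+1, m)) (D : 'M[R[i]]_((n + m).+1, 1 + m)),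
     int_gale_dual (exponent_mx a) B -> gale_dual C D -> reduced D ->
     forall mu : nat,
       sparse_isolated_mult C a (const_mx 1) mu <-> gale_isolated_mult B D 0 mu)
  /\
  (forall (B B' : 'M[int]_((n + m).+1, m))
          (D D' : 'M[R[i]]_((n + m).+1, 1 + m)),
     int_gale_dual (exponent_mx a) B -> int_gale_dual (exponent_mx a) B' ->
     gale_dual C D -> reduced D -> gale_dual C D' -> reduced D' ->
     forall mu : nat,
       gale_isolated_mult B D 0 mu <-> gale_isolated_mult B' D' 0 mu).
Proof.
have main (B : 'M[int]_(_, m)) (D : 'M[R[i]]_(_, 1 + m)) :
    int_gale_dual (exponent_mx a) B -> gale_dual C D -> reduced D ->
    forall mu, sparse_isolated_mult C a (const_mx 1) mu <-> gale_isolated_mult B D 0 mu.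
  by move=> galeB galeD redD mu; exact: (sparse_gale_mult mu a_hyp C_ones galeB galeD redD).
split=> [//|B B' D D' galeB galeB' galeD redD galeD' redD' mu].
by rewrite -(main B D) // -(main B' D').
Qed.
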